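(* Let $b \geq 3$ be an integer and let $D \subset \{0,1,\ldots,b-1\}$ with $2 \leq \#D \leq b-1$. Let $C(b,D)$ be the corresponding generalized Cantor set, with Hausdorff dimension $\gamma = \log \#D / \log b$. Let $m = \min\{ \min D,\ b-1-\max D \}$. Let $f$ be a dimension function such that $r \mapsto r^{-\gamma} f(r)$ is monotonic, and let $\psi : \mathbb{N} \to (0,\infty)$ be any function. Then $$\mathcal{H}^{f} (W_{b}(\psi) \cap C(b,D)) = \begin{cases} 0, &\text{ if } \displaystyle\sum_{n \geq 1 \colon \psi(n) > \frac{m}{(b-1)b^n}} f\left(\psi(n) - \frac{m}{(b-1)b^n}\right) b^{n \gamma} < \infty, \\[2ex] \mathcal{H}^{f}(C(b,D)), &\text{ if } \displaystyle\sum_{n \geq 1 \colon \psi(n) > \frac{m}{(b-1)b^n}} f\left(\psi(n) - \frac{m}{(b-1)b^n}\right) b^{n \gamma} = \infty. \end{cases}$$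
   Context: The generalized Cantor set $C(b,D)$ is the set of real numbers $x \in [0,1]$ whose base-$b$ expansion uses only digits from $D$. A dimension function is a continuous, non-decreasing function $f:(0,\infty)\to(0,\infty)$ with $\lim_{r\to 0} f(r)=0$; $\mathcal{H}^f$ is the Hausdorff $f$-measure. For an integer $t\ge 2$ and $\psi:\mathbb{N}\to(0,\infty)$, $W_{t}(\psi) = \{x \in [0,1] : |x - p/t^n| < \psi(n) \text{ for infinitely many } (p,n) \in \mathbb{N}^2\}$. *)

(* Defs.v *)
From HB Require Import structures.
From mathcomp Require Import all_boot all_order all_algebra.
From mathcomp Require Import all_classical all_reals all_analysis.
Set Implicit Arguments. Unset Strict Implicit. Unset Printing Implicit Defensive.
Import Order.TTheory GRing.Theory Num.Theory.
Import numFieldNormedType.Exports.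
Local Open Scope classical_set_scope.
Local Open Scope ring_scope.

Section Defs.
Variable R : realType.

(* diameter of a subset of R (extended real; -oo for the empty set) *)
Definition diam (A : set R) : \bar R :=
  ereal_sup [set (`|x - y|)%:E | x in A & y in A].

(* contribution f(diam U) of a covering set; sets of diameter 0
   (empty sets, singletons) contribute 0, i.e. the convention f(0) = 0 *)
Definition hcontrib (f : R -> R) (U : set R) : \bar R :=
  match diam U with
  | r%:E => if 0 < r then (f r)%:E else 0%E
  | _ => 0%E
  end.

Definition hausdorff_content (f : R -> R) (delta : R) (A : set R) : \bar R :=
  ereal_inf [set (\sum_(0 <= i <oo) hcontrib f (U i))%E
            | U in [set U : nat -> set R |
                     A `<=` \bigcup_i U i /\ (forall i, (diam (U i) <= delta%:E)%E)]].

(* Hausdorff f-measure: limit as delta -> 0+, equal to the sup over delta > 0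
   since the content is nonincreasing in delta *)
Definition hausdorff_measure (f : R -> R) (A : set R) : \bar R :=
  ereal_sup [set hausdorff_content f delta A | delta in [set d : R | 0 < d]].

(* dimension function: continuous, non-decreasing, positive on (0,oo),
   tending to 0 at 0+ (values outside (0,oo) are irrelevant) *)
Definition dimension_function (f : R -> R) : Prop :=
  [/\ forall r, 0 < r -> 0 < f r,
      {within [set r : R | 0 < r], continuous f},
      (forall r s, 0 < r -> r <= s -> f r <= f s) &
      f x @[x --> 0^'+] --> 0].

Definition monotonic_pos (g : R -> R) : Prop :=
  (forall r s, 0 < r -> r <= s -> g r <= g s) \/
  (forall r s, 0 < r -> r <= s -> g s <= g r).

Definition cantor_set (b : nat) (D : {set 'I_b}) : set R :=
  [set x | exists a : nat -> 'I_b, (forall n, a n \in D) /\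
     series (fun n => (val (a n))%:R / (b%:R ^+ n.+1)) @ \oo --> x].

Definition W_set (t : nat) (psi : nat -> R) : set R :=
  [set x | 0 <= x <= 1 /\
     infinite_set [set pn : nat * nat |
        `|x - pn.1%:R / (t%:R ^+ pn.2)| < psi pn.2]].

Definition digit_gap (b : nat) (D : {set 'I_b}) : nat :=
  minn (\big[minn/b]_(d in D) val d) (b.-1 - \max_(d in D) val d).

End Defs.

(* Main.v *)
(** Write q = 1/#D, F(k) = f(b^-k), G(k) = F(k) #D^k, and r_n for psi(n) minus the
    gap m/((b-1)b^n).  Every point of C(b,D) is at distance at least m/((b-1)b^n) from
    b^-n Z, so a point lies in W iff for infinitely many n it is within r_n of an extreme
    point of its level-n cylinder; up to constants, iff the digits n, ..., s_n - 1 are all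
    equal to an extreme digit e, where b^-(s_n) is about r_n.

    Convergence: the level-n part of W is covered by 2 #D^n sets of diameter at most r_n.

    Divergence is proved by counting words.  Decomposing according to the last run that
    occurs, the proportion of words meeting no run of length l_n at position n is at most
    2/(S+2), with S = sum q^(l_n).
    If G is bounded, the complement of W in C is therefore covered by a vanishing
    proportion of the cylinders of a high level, so it is H^f-null.
    If G is unbounded, it is nondecreasing and H^f of the intersection is infinite.  A
    cover of small total cost induces a superadditive cost Phi on words.  Below a word u
    with Phi(u) < F(|u|)/2, the runs of length t_n - n, with q^(t_n) of order
    F(s_n)/G(|u|), cover almost everything (they are the balls of measure f(r) of the mass
    transference principle), while by the maximal inequality most points avoid prefixes
    of large cost.  So some such run can be prolonged to s_n keeping Phi < F/2;
    iterating yields a point of W missed by the cover. *)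

Require Import Defs.
From mathcomp Require Import all_boot all_order all_algebra.
From mathcomp Require Import all_classical all_reals all_analysis.
From mathcomp Require Import ring lra zify.
Set Implicit Arguments. Unset Strict Implicit. Unset Printing Implicit Defensive.
Import Order.TTheory GRing.Theory Num.Theory.
Import numFieldNormedType.Exports.
Local Open Scope classical_set_scope.
Local Open Scope ring_scope.

(** * Averages over words *)

Section Words.
Variables (T : finType) (D : {set T}).

Fixpoint words n : seq (seq T) :=
  if n is n'.+1 then [seq d :: w | d <- enum D, w <- words n'] else [:: [::]].

Lemma mem_words n w : (w \in words n) = (size w == n) && all [in D] w.
Proof.
elim: n w => [|n IH] [|d w] //=.
- by apply/negbTE/allpairsP => -[[x y] /= [_ _]].
- apply/allpairsP/idP => [[[x y] /= [xD yw [-> ->]]]|].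
    by move: yw; rewrite IH eqSS => /andP[-> ->]; rewrite -mem_enum xD.
  rewrite eqSS => /andP[sw /andP[dD wD]]; exists (d, w); split => //=.
    by rewrite mem_enum.
  by rewrite IH sw.
Qed.

Lemma size_words n : size (words n) = (#|D| ^ n)%N.
Proof. by elim: n => //= n IH; rewrite size_allpairs IH -cardE expnS. Qed.

Lemma words_uniq n : uniq (words n).
Proof.
elim: n => //= n IH; apply: allpairs_uniq => //; first exact: enum_uniq.
by move=> [x y] [x' y'] _ _ /= [-> ->].
Qed.

Lemma big_wordsS (R : nmodType) n (g : seq T -> R) :
  \sum_(w <- words n.+1) g w = \sum_(d in D) \sum_(w <- words n) g (d :: w).
Proof. by rewrite /= big_allpairs_dep big_enum. Qed.

Lemma big_words_cat (R : nmodType) m n (g : seq T -> R) :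
  \sum_(w <- words (m + n)) g w =
  \sum_(u <- words m) \sum_(v <- words n) g (u ++ v).
Proof.
elim: m g => [|m IH] g; first by rewrite big_seq1.
by rewrite addSn !big_wordsS; apply: eq_bigr => d _; rewrite IH.
Qed.

End Words.

Section Average.
Variables (R : realFieldType) (T : finType) (D : {set T}).
Hypothesis D2 : (2 <= #|D|)%N.

Notation words := (words D).
Notation q := (#|D|%:R^-1 : R).

(** The expectation of [g] over n independent uniform digits of [D]. The natural measure of the
    Cantor set enters only through these finite averages. *)
Definition avg n (g : seq T -> R) : R := q ^+ n * \sum_(w <- words n) g w.

Lemma card_gt0R : 0 < #|D|%:R :> R.
Proof. by rewrite ltr0n (leq_trans _ D2). Qed.

Lemma q_gt0 : 0 < q.
Proof. by rewrite invr_gt0 card_gt0R. Qed.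

Lemma q_le_half : q <= 2^-1.
Proof. by rewrite lef_pV2 ?posrE ?card_gt0R ?ltr0n// ler_nat. Qed.

Lemma avg0 g : avg 0 g = g [::].
Proof. by rewrite /avg expr0 mul1r big_seq1. Qed.

Lemma avgS n g : avg n.+1 g = q * \sum_(d in D) avg n (fun w => g (d :: w)).
Proof. by rewrite /avg big_wordsS exprS -mulrA mulr_sumr. Qed.

Lemma le_avg n g h : {in words n, forall w, g w <= h w} -> avg n g <= avg n h.
Proof.
move=> gh; apply: ler_wpM2l; first by rewrite exprn_ge0 ?ltW ?q_gt0.
by rewrite big_seq [leRHS]big_seq ler_sum.
Qed.

Lemma eq_avg n g h : {in words n, forall w, g w = h w} -> avg n g = avg n h.
Proof. by move=> gh; congr (_ * _); apply: eq_big_seq. Qed.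

Lemma avg_cst n c : avg n (fun=> c) = c.
Proof.
rewrite /avg big_const_seq count_predT iter_addr_0 size_words.
rewrite -[c *+ _]mulr_natl natrX mulrA -exprMn mulVf ?expr1n ?mul1r//.
by rewrite gt_eqF ?card_gt0R.
Qed.

Lemma avgD n g h : avg n (fun w => g w + h w) = avg n g + avg n h.
Proof. by rewrite /avg big_split mulrDr. Qed.

Lemma avgZ n c g : avg n (fun w => c * g w) = c * avg n g.
Proof. by rewrite /avg -mulr_sumr mulrCA. Qed.

Lemma avgZr n c g : avg n (fun w => g w * c) = avg n g * c.
Proof. by rewrite /avg -mulr_suml mulrA. Qed.

Lemma avgB n g h : avg n (fun w => g w - h w) = avg n g - avg n h.
Proof. by rewrite /avg sumrB mulrBr. Qed.

Lemma avg_sum I (r : seq I) (P : pred I) n (g : I -> seq T -> R) :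
  avg n (fun w => \sum_(i <- r | P i) g i w) = \sum_(i <- r | P i) avg n (g i).
Proof. by rewrite /avg exchange_big mulr_sumr. Qed.

Lemma avg_cat m n g : avg (m + n) g = avg m (fun u => avg n (fun v => g (u ++ v))).
Proof. by rewrite /avg big_words_cat exprD -mulrA mulr_sumr. Qed.

Lemma avg_ge0 n g : (forall w, 0 <= g w) -> 0 <= avg n g.
Proof. by move=> g0; rewrite -(avg_cst n 0) le_avg. Qed.

Lemma avg_lt_ex n g c : avg n g < c -> exists2 w, w \in words n & g w < c.
Proof.
move=> gc; apply/hasP; apply: contraTT gc => /hasPn gc.
by rewrite -leNgt -(avg_cst n c) le_avg// => w /gc; rewrite -leNgt.
Qed.

Fixpoint hits (P : pred (seq T)) u z :=
  P u || if z is d :: z' then hits P (rcons u d) z' else false.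

Lemma hits_take (P : pred (seq T)) u z i : P (u ++ take i z) -> hits P u z.
Proof.
elim: z u i => [|d z IH] u i /=; first by rewrite cats0 => ->.
case: i => [|i]; first by rewrite cats0 => ->.
by rewrite -cat_rcons => /IH ->; rewrite orbT.
Qed.

(* The weak-type (1,1) maximal inequality for the supermartingale Phi(w) #|D|^|w|. *)
Lemma avg_hits_le (Phi : seq T -> R) lam n u :
  (forall w, 0 <= Phi w) ->
  (forall w, \sum_(d in D) Phi (rcons w d) <= Phi w) -> 0 < lam ->
  avg n (fun z => (hits (fun w => lam * q ^+ size w <= Phi w) u z)%:R)
    <= Phi u / (lam * q ^+ size u).
Proof.
move=> Phi0 Phisup lam0; elim: n u => [|n IH] u.
  rewrite avg0/= orbF; have [h|h] := leP (lam * q ^+ size u) (Phi u).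
    by rewrite ler_pdivlMr ?mul1r// mulr_gt0// exprn_gt0// q_gt0.
  by rewrite divr_ge0// mulr_ge0 ?exprn_ge0// ltW// q_gt0.
have lq0 k : 0 < lam * q ^+ k by rewrite mulr_gt0// exprn_gt0// q_gt0.
(* If [u] is already a hit, the bound is at least 1. Otherwise the bounds for the children are
   averaged, and the factor q cancels the extra letter in the threshold. *)
have [h|h] := leP (lam * q ^+ size u) (Phi u).
  apply: (@le_trans _ _ 1); last by rewrite ler_pdivlMr ?mul1r.
  by rewrite -[leRHS](avg_cst n.+1); apply: le_avg => w _; rewrite lern1 leq_b1.
rewrite avgS/= [_ <= Phi u]leNgt h/=.
apply: (@le_trans _ _ (q * \sum_(d in D) Phi (rcons u d) / (lam * q ^+ (size u).+1))).
  rewrite ler_wpM2l ?(ltW q_gt0)// ler_sum// => d _.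
  by rewrite -(size_rcons u d); apply: IH.
rewrite -mulr_suml exprS [lam * (_ * _)]mulrCA [(q * _)^-1]invfM [leLHS]mulrCA.
rewrite [q * (q^-1 * _)]mulrA divff ?gt_eqF ?q_gt0// mul1r.
by rewrite ler_wpM2r// invr_ge0 ltW.
Qed.

(** * Runs of a fixed digit in random words *)

Section Runs.
Variable e : T.
Hypothesis eD : e \in D.

Definition run n l (z : seq T) := prefix (nseq l e) (drop n z).

Lemma avg_prefix n l : (l <= n)%N -> avg n (fun z => (prefix (nseq l e) z)%:R) = q ^+ l.
Proof.
elim: n l => [|n IH] [|l] // ln; first by rewrite avg0.
  rewrite -[RHS](avg_cst n.+1); apply: eq_avg => w _.
  by rewrite prefix0s.
rewrite avgS exprS -(IH l)// (bigD1 e)//= big1 ?addr0.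
  by congr (_ * _); apply: eq_avg => w _; rewrite eqxx.
move=> d /andP[_ /negPf de].
by rewrite -[RHS](avg_cst n); apply: eq_avg => w _; rewrite eq_sym de.
Qed.

Lemma avg_run Z n l : (n + l <= Z)%N -> avg Z (fun z => (run n l z)%:R) = q ^+ l.
Proof.
move=> nlZ; have nZ : (n <= Z)%N by apply: leq_trans nlZ; rewrite leq_addr.
rewrite -(subnKC nZ) avg_cat -[RHS](avg_cst n); apply: eq_avg => u.
rewrite mem_words => /andP[/eqP su _]; rewrite -(@avg_prefix (Z - n)); last by rewrite leq_subRL.
by apply: eq_avg => v _; rewrite /run drop_cat su ltnn subnn drop0.
Qed.

(** The portion of a run lying inside [u] depends on [u] alone, which gives independence from the
    later digits. *)
Lemma run_catl n l u v : (n <= size u)%N -> run n l (u ++ v) -> run n (minn l (size u - n)) u.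
Proof.
move=> nu; rewrite /run drop_cat; case: ltnP => [_|un]; last first.
  have -> : size u = n by apply/eqP; rewrite eqn_leq nu un.
  by rewrite subnn minn0 prefix0s.
move=> /prefixP[s' H]; rewrite -(size_drop n u).
have := congr1 (take (minn l (size (drop n u)))) H.
rewrite !take_cat size_nseq.
set m := minn _ _; have ml : (m <= l)%N by rewrite geq_minl.
have md : (m <= size (drop n u))%N by rewrite geq_minr.
have -> : (if (m < size (drop n u))%N then take m (drop n u) else
   drop n u ++ take (m - size (drop n u)) v) = take m (drop n u).
  case: ltnP => // dm; have -> : m = size (drop n u) by apply/eqP; rewrite eqn_leq md dm.
  by rewrite subnn take0 cats0 take_size.
have -> : (if (m < l)%N then take m (nseq l e) else nseq l e ++ take (m - l) s') = nseq m e.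
  case: ltnP => [_|lm]; first by rewrite take_nseq.
  have -> : m = l by apply/eqP; rewrite eqn_leq ml lm.
  by rewrite subnn take0 cats0.
by move=> tk; rewrite -tk prefix_take.
Qed.

Lemma run_catr n l u v : run (size u + n) l (u ++ v) = run n l v.
Proof. by rewrite /run drop_cat ltnNge leq_addr/= addKn. Qed.

Lemma run_nth n l z i : run n l z -> (n <= i < n + l)%N -> nth e z i = e.
Proof.
rewrite /run prefixE size_nseq => /eqP rz /andP[ni il].
rewrite -(subnKC ni) -nth_drop -(@nth_take l) ?ltn_subLR// rz nth_nseq.
by case: ifP.
Qed.

Variables (l : nat -> nat) (J : pred nat) (M Z : nat).
Hypothesis lZ : forall n, (n < M)%N -> J n -> (n + l n <= Z)%N.
Hypothesis MZ : (M <= Z)%N.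

(** [H k.+1] implies [H k], so the difference [L k] is the indicator that the last admissible run
    starting before [M] starts exactly at [k]. *)
Let H k z := has (fun n => J n && run n (l n) z) (index_iota k M).
Let L k z : R := (H k z)%:R - (H k.+1 z)%:R.

Let L_ge0 k z : 0 <= L k z.
Proof.
rewrite subr_ge0 ler_nat /H /index_iota subnS.
by case: (M - k)%N => //= n; case: (has _ _); rewrite ?orbT.
Qed.

Let sum_L j z : (j <= M)%N -> \sum_(j <= k < M) L k z = (H j z)%:R.
Proof.
move=> jM; rewrite -[LHS]opprK -sumrN.
under eq_bigr do rewrite opprB.
by rewrite telescope_sumr// {1}/H /index_iota subnn/= sub0r opprK.
Qed.

Let H_catr k u v : size u = k ->
  H k (u ++ v) = has (fun n => J n && run (n - k) (l n) v) (index_iota k M).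
Proof.
move=> su; apply: eq_in_has => n; rewrite mem_index_iota => /andP[kn _].
by rewrite -[X in run X _ (_ ++ _)](subnKC kn) -su run_catr.
Qed.

Let HS_catr k u v : size u = k ->
  H k.+1 (u ++ v) = has (fun n => J n && run (n - k) (l n) v) (index_iota k.+1 M).
Proof.
move=> su; apply: eq_in_has => n; rewrite mem_index_iota => /andP[/ltnW kn _].
by rewrite -[X in run X _ (_ ++ _)](subnKC kn) -su run_catr.
Qed.

(* Given that the last run starts at k, the digits before k are still uniform. *)
Let avg_run_last j k : (j <= k)%N -> (k < M)%N -> J j ->
  avg Z (fun z => (run j (l j) z)%:R * L k z)
    <= (q ^+ l j + q ^+ (k - j)) * avg Z (L k).
Proof.
move=> jk kM Jj; have kZ : (k <= Z)%N by rewrite (leq_trans (ltnW kM)).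
rewrite -(subnKC kZ) !avg_cat.
pose L' v : R := (has (fun n => J n && run (n - k) (l n) v) (index_iota k M))%:R
  - (has (fun n => J n && run (n - k) (l n) v) (index_iota k.+1 M))%:R.
have LL' u v : u \in words k -> L k (u ++ v) = L' v.
  by rewrite mem_words => /andP[/eqP su _]; rewrite /L H_catr// HS_catr.
set a := avg (Z - k) L'.
have -> : avg k (fun u => avg (Z - k) (fun v => L k (u ++ v))) = a.
  by rewrite -(avg_cst k a); apply: eq_avg => u uk; apply: eq_avg => v _; rewrite LL'.
have a0 : 0 <= a.
  have := @avg_ge0 (k + (Z - k)) (L k) (L_ge0 k); rewrite avg_cat.
  suff -> : avg k (fun u => avg (Z - k) (fun v => L k (u ++ v))) = a by [].
  by rewrite -(avg_cst k a); apply: eq_avg => u uk; apply: eq_avg => v _; rewrite LL'.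
(* The run at [j] is cut at [k]: what remains depends on the first k digits only, whereas [L k] is a
   function [L'] of the others. *)
apply: (@le_trans _ _ (avg k (fun u => (run j (minn (l j) (k - j)) u)%:R * a))).
  apply: le_avg => u uk; rewrite -avgZ; apply: le_avg => v vk.
  rewrite LL'//; have L'0 : 0 <= L' v by rewrite -(LL' u).
  rewrite ler_wpM2r// ler_nat.
  move: uk; rewrite mem_words => /andP[/eqP su _].
  have := @run_catl j (l j) u v; rewrite su => /(_ jk).
  by case: (run j _ (u ++ v)) => // /(_ isT) ->.
rewrite avgZr ler_wpM2r// avg_run; last first.
  by rewrite -leq_subRL// geq_minr.
(* The cut run has probability q to the minimum of [l j] and [k - j], hence at most the sum of the
   two powers. *)
have [h|h] := leqP (l j) (k - j); first by rewrite lerDl exprn_ge0// ltW// q_gt0.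
by rewrite lerDr exprn_ge0// ltW// q_gt0.
Qed.

Lemma geometric_q_le k : \sum_(j < k.+1) q ^+ (k - j) <= 2.
Proof.
have -> : \sum_(j < k.+1) q ^+ (k - j) = \sum_(j < k.+1) q ^+ j.
  rewrite (reindex_inj rev_ord_inj)/=; apply: eq_bigr => j _.
  by rewrite subSS subKn// -ltnS.
have q1 : 0 < 1 - q.
  by rewrite subr_gt0 (le_lt_trans q_le_half)// invf_lt1 ?ltr0n ?ltr1n.
apply: (@le_trans _ _ (1 - q)^-1); last first.
  by rewrite -[leRHS]invrK lef_pV2 ?posrE ?invr_gt0// lerBrDr -lerBrDl (le_trans q_le_half)//; lra.
rewrite -(ler_pM2l q1) divff ?gt_eqF// -opprB mulNr -subrX1 opprB.
by rewrite lerBlDr lerDl exprn_ge0// ltW// q_gt0.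
Qed.

(** [S] is the expected number of runs. Splitting it over the position [k] of the last run bounds it
    by S + 2 times the probability of some run: the terms q^(l j) sum to at most S, and the terms
    q^(k - j), which account for overlaps, to at most 2. *)
Lemma avg_avoid_runs (S := \sum_(0 <= n < M | J n) q ^+ l n) :
  avg Z (fun z => (~~ has (fun n => J n && run n (l n) z) (index_iota 0 M))%:R)
    * (S + 2) <= 2.
Proof.
have S0 : 0 <= S by apply: sumr_ge0 => n _; rewrite exprn_ge0// ltW// q_gt0.
suff : S <= avg Z (fun z => (H 0 z)%:R) * (S + 2).
  have -> : avg Z (fun z => (~~ H 0 z)%:R) = 1 - avg Z (fun z => (H 0 z)%:R).
    rewrite -[X in X - _](avg_cst Z) -avgB; apply: eq_avg => z _.
    by case: (H 0 z); rewrite ?subrr ?subr0.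
  by move=> h; rewrite mulrBl mul1r lerBlDl lerD2r.
have -> : avg Z (fun z => (H 0 z)%:R) = \sum_(0 <= k < M) avg Z (L k).
  by rewrite -avg_sum; apply: eq_avg => z _; rewrite sum_L.
rewrite mulr_suml.
(* When there is a run at [j], the last run starts at or after [j], so the [L k] with j <= k sum to
   1. *)
have {1}-> : S = \sum_(0 <= j < M | J j) \sum_(j <= k < M)
    avg Z (fun z => (run j (l j) z)%:R * L k z).
  rewrite /S big_nat_cond [RHS]big_nat_cond; apply: eq_bigr => j /andP[/andP[_ jM] Jj].
  rewrite -avg_sum -(@avg_run Z j)// ?lZ//; apply: eq_avg => z _.
  rewrite -mulr_sumr sum_L ?(ltnW jM)// /H.
  case: (boolP (run j _ z)) => rj; rewrite ?mul0r// mul1r.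
  suff -> : has (fun n => J n && run n (l n) z) (index_iota j M) by [].
  by apply/hasP; exists j; rewrite ?mem_index_iota ?leqnn// Jj.
apply: (@le_trans _ _ (\sum_(0 <= j < M | J j) \sum_(0 <= k < M | (j <= k)%N)
   (q ^+ l j + q ^+ (k - j)) * avg Z (L k))).
  rewrite big_nat_cond [leRHS]big_nat_cond; apply: ler_sum => j /andP[/andP[_ jM] Jj].
  rewrite (big_nat_widenl _ 0)//=.
  rewrite big_nat_cond [leRHS]big_nat_cond; apply: ler_sum => k /andP[/andP[_ kM] jk].
  exact: avg_run_last.
rewrite (exchange_big_dep_nat predT)//= big_nat [leRHS]big_nat.
apply: ler_sum => k kM; rewrite -mulr_suml mulrC ler_wpM2l ?avg_ge0//.
rewrite big_split/= lerD//.
  rewrite /S big_mkcond [leRHS]big_mkcond/= ler_sum// => j _.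
  by case: (J j) => //=; case: ifP => _; rewrite ?lexx ?exprn_ge0 ?(ltW q_gt0).
apply: le_trans (geometric_q_le k); have {}kM : (k.+1 <= M)%N by case/andP: kM.
rewrite (big_cat_nat (n := k.+1))//= [X in _ + X]big_nat_cond [X in _ + X]big1 ?addr0; last first.
  by move=> j /andP[/andP[kj _]]; rewrite leqNgt kj andbF.
rewrite -(big_mkord predT (fun j => q ^+ (k - j))) big_mkcond [leRHS]big_mkcond/= ler_sum// => j _.
by case: ifP => _; rewrite ?lexx ?exprn_ge0 ?(ltW q_gt0).
Qed.

End Runs.
End Average.

(** * Divergence through finite partial sums *)

Section Divergence.
Variable R : realType.

Definition diverges (J : pred nat) (a : nat -> R) :=
  forall B N, exists M, B < \sum_(N <= n < M | J n) a n.

Lemma sum_nat_le_widen (J : pred nat) (a : nat -> R) m n p :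
  (forall i, J i -> 0 <= a i) -> (m <= n)%N ->
  \sum_(n <= i < p | J i) a i <= \sum_(m <= i < p | J i) a i.
Proof.
move=> a0 mn; rewrite (big_nat_widenl n m)//= big_mkcond [leRHS]big_mkcond/= ler_sum// => i _.
by case: (boolP (J i)) => //= /a0 ?; case: ifP.
Qed.

(** In the applications 1 <= c n means an empty run. If such levels recur forever, they alone make
    the sum of [c] diverge; otherwise the comparison with [a] holds from some level on. *)
Lemma diverges_compare (J : pred nat) (a c : nat -> R) (K : R) n0 :
  (forall n, 0 <= c n) -> 0 < K -> diverges J a ->
  (forall n, (n0 <= n)%N -> J n -> 1 <= c n \/ a n <= K * c n) -> diverges J c.
Proof.
move=> c0 K0 diva ac B N.
have [[n1 Hn1]|inf] := pselect (exists n1, forall n, (n1 <= n)%N -> J n -> c n < 1).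
  have [M HM] := diva (K * B) (maxn N (maxn n0 n1)); exists M.
  rewrite -(ltr_pM2l K0) (lt_le_trans HM)//.
  apply: (@le_trans _ _ (K * \sum_(maxn N (maxn n0 n1) <= i < M | J i) c i)); last first.
    by rewrite ler_pM2l// sum_nat_le_widen// leq_maxl.
  rewrite mulr_sumr big_nat_cond [leRHS]big_nat_cond ler_sum// => n /andP[/andP[+ _] Jn].
  rewrite !geq_max => /and3P[_ n0n n1n].
  by have [|//] := ac n n0n Jn; rewrite leNgt Hn1.
have {}inf n1 : exists n, [/\ (n1 <= n)%N, J n & 1 <= c n].
  apply: contra_notP inf => H; exists n1 => n n1n Jn; rewrite ltNge.
  by apply/negP => cn; apply: H; exists n.
suff {B} H k : exists M, (k%:R : R) <= \sum_(N <= n < M | J n) c n.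
  have [M HM] := H (Num.bound `|B|); exists M.
  by rewrite (lt_le_trans _ HM)// (le_lt_trans (ler_norm _))// archi_boundP.
elim: k => [|k [M HM]]; first by exists N; rewrite big_geq.
have [n [Mn Jn cn]] := inf (maxn M N).
move: Mn; rewrite geq_max => /andP[Mn Nn].
exists n.+1.
have -> : \sum_(N <= i < n.+1 | J i) c i = \sum_(N <= i < n | J i) c i + c n.
  by rewrite big_mkcond big_nat_recr//= Jn -big_mkcond.
rewrite -natr1 lerD// (le_trans HM)//.
have [NM|MN] := leqP N M; last by rewrite big_geq ?(ltnW MN)// sumr_ge0.
by rewrite (big_cat_nat NM Mn)/= lerDl sumr_ge0.
Qed.

End Divergence.

(** * Limsup sets avoiding a cheap family of words *)

Section Avoidance.
Variables (R : realType) (T : finType) (D : {set T}) (e : T).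
Hypotheses (D2 : (2 <= #|D|)%N) (eD : e \in D).
Notation q := (#|D|%:R^-1 : R).
Variables (F G : nat -> R) (Phi : seq T -> R) (Bad : seq T -> Prop).
Hypotheses (GE : forall n, G n = F n * #|D|%:R ^+ n)
  (F0 : forall n, 0 < F n) (Fni : forall m n, (m <= n)%N -> F n <= F m)
  (Gnd : forall m n, (m <= n)%N -> G m <= G n).
Hypotheses (Phi0 : forall w, 0 <= Phi w)
  (PhiS : forall w, \sum_(d in D) Phi (rcons w d) <= Phi w)
  (BadPhi : forall w, Bad w -> F (size w) <= Phi w)
  (Phi_lim : forall eps, 0 < eps ->
     exists K, forall k, (K <= k)%N -> \sum_(w <- words D k) Phi w < eps).
Variables (J : pred nat) (s : nat -> nat) (a : nat -> R) (K : R).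
Hypotheses (sge : forall n, (n <= s n)%N) (K0 : 0 < K) (diva : diverges J a)
  (as_le : forall n, J n -> s n = n \/ a n <= K * (F (s n) * #|D|%:R ^+ n)).

Let qn0 n : 0 < q ^+ n. Proof. by rewrite exprn_gt0// q_gt0. Qed.

Let GF n : G n * q ^+ n = F n.
Proof.
by rewrite GE -mulrA -exprMn divff ?expr1n ?mulr1// gt_eqF// card_gt0R.
Qed.

Let G0 n : 0 < G n.
Proof. by rewrite GE mulr_gt0// exprn_gt0// card_gt0R. Qed.

Lemma superadditive_cat_le w z : all [in D] z -> Phi (w ++ z) <= Phi w.
Proof.
elim: z w => [|d z IH] w/=; first by rewrite cats0.
move=> /andP[dD /IH zD]; rewrite -cat_rcons (le_trans (zD _))//.
by rewrite (le_trans _ (PhiS w))// (bigD1 d)//= lerDl sumr_ge0.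
Qed.

(** A bad word of the same length as [u] would cost at least F(|u|). The spare factor 2 is what the
    maximal inequality below [u] uses up. *)
Definition good u := [/\ all [in D] u, forall i, ~ Bad (take i u) & Phi u < 2^-1 * F (size u)].

Let sum_ext_le u m : u \in words D (size u) ->
  \sum_(z <- words D m) Phi (u ++ z) <= \sum_(w <- words D (size u + m)) Phi w.
Proof.
move=> uD; rewrite big_words_cat [leRHS](bigD1_seq u) ?words_uniq//= lerDl.
by rewrite sumr_ge0// => *; rewrite sumr_ge0.
Qed.

Let natb_lt1 (b : bool) (x : R) : 0 <= x -> b%:R + x < 1 -> ~~ b.
Proof. by case: b => //= x0; rewrite ltNge lerDl x0. Qed.

(* N1 is so deep that the total cost of the words of length N1 is negligible. *)
Lemma good_descend u : good u -> exists N1 u1,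
  [/\ (size u < N1)%N, size u1 = N1, prefix u u1, all [in D] u1 &
     (forall i, ~ Bad (take i u1)) /\ Phi u1 < 4^-1 * (G (size u) * q ^+ N1)].
Proof.
move=> [uD uB uPhi]; set N := size u.
have e0 : 0 < 8^-1 * F N by rewrite mulr_gt0// invr_gt0.
have [K1 HK] := Phi_lim e0.
pose m := (K1 - N).+1; exists (N + m)%N.
pose Q := 4^-1 * (G N * q ^+ (N + m)).
have Q0 : 0 < Q by apply: mulr_gt0; [rewrite invr_gt0 | exact: mulr_gt0].
(* Both means are below 1/2, the first by the maximal inequality at threshold G N, the second by
   Markov and the choice of 1/8 above. A word with sum below 1 has no hit and costs less than
   [Q]. *)
have : avg D m (fun z => (hits (fun w => G N * q ^+ size w <= Phi w) u z)%:R
    + Phi (u ++ z) / Q) < 1.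
  rewrite avgD [ltRHS]splitr ltrD//.
    apply: (le_lt_trans (avg_hits_le D2 _ _ Phi0 PhiS (G0 N))) => //.
    by rewrite GF ltr_pdivrMr// mul1r.
  rewrite avgZr ltr_pdivrMr// /avg.
  have -> : 1 / 2 * Q = q ^+ m * (8^-1 * F N) by rewrite /Q -(GF N) exprD; lra.
  rewrite ltr_pM2l// (le_lt_trans (sum_ext_le _ _))// ?HK//; first by rewrite mem_words eqxx.
  by rewrite /m /N addnS leqW// -leq_subLR.
move=> /(avg_lt_ex D2)[z]; rewrite mem_words => /andP[/eqP sz zD] H.
have P0 : 0 <= Phi (u ++ z) / Q by rewrite divr_ge0// ltW.
exists (u ++ z); split; rewrite ?size_cat ?sz ?prefix_prefix ?all_cat ?uD ?zD//.
  by rewrite /m addnS ltnS leq_addr.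
have nh := natb_lt1 P0 H; split; last first.
  rewrite -/Q -[ltRHS]mul1r -ltr_pdivrMr// (le_lt_trans _ H)// lerDr.
  by rewrite ler0n.
move=> i; rewrite take_cat; case: ltnP => [_|Ni]; first exact: uB.
(* Since G is nondecreasing, a bad word w extending [u] costs at least G(|w|) q^|w| >= G(|u|) q^|w|,
   so it would be a hit. *)
move=> B; move/negP: nh; apply; apply: (@hits_take _ _ _ _ (i - size u)%N).
have := BadPhi B; rewrite -GF => /(le_trans _); apply.
by rewrite ler_pM2r// Gnd// size_cat leq_addr.
Qed.

Let threshold N n : (N <= n)%N -> exists t,
  [/\ (n <= t)%N, (t <= s n)%N, G N * q ^+ t <= F (s n) &
      t = n \/ (n < t)%N /\ F (s n) < G N * q ^+ t.-1].
Proof.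
move=> Nn; pose P t := (n <= t)%N && (G N * q ^+ t <= F (s n)).
have Ps : P (s n) by rewrite /P sge/= -(GF (s n)) ler_pM2r// Gnd// (leq_trans Nn).
case: (ex_minnP (ex_intro P _ Ps)) => t /andP[nt tF] tmin.
exists t; split => //; first exact: tmin.
case: (ltngtP n t) nt => // [nt _|->]; [right|by left].
split=> //; rewrite ltNge; apply/negP => h.
have : P t.-1 by rewrite /P h andbT; clear -nt; lia.
by move/tmin; clear -nt; lia.
Qed.

(** Among long extensions of a deep word [u1] below [u], fewer than half avoid all the shortened
    runs from n to t n, and fewer than half pass through a word w of cost at least half of G N
    q^|w|. An extension in neither class is cut at the end of its run and continued with [e] up to
    length [s n]. *)
Lemma good_extend u : good u -> exists v n,
  [/\ good v, prefix u v, (size u < n <= size v)%N, J n & size v = s n /\ run e n (s n - n) v].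
Proof.
move=> gu; have [N1 [u1 [NN1 su1 uu1 u1D [u1B u1P]]]] := good_descend gu.
set N := size u in NN1 u1P *.
have /choice[t Ht] : forall n, exists t, (N <= n)%N -> [/\ (n <= t)%N, (t <= s n)%N,
    G N * q ^+ t <= F (s n) & t = n \/ (n < t)%N /\ F (s n) < G N * q ^+ t.-1].
  move=> n; have [Nn|nN] := leqP N n; last by exists 0%N.
  by have [t ?] := threshold Nn; exists t.
pose c n := q ^+ (t n - n).
have divc : diverges J c.
  apply: (@diverges_compare _ _ a c (K * (G N * #|D|%:R)) N) => //.
  - by move=> n; rewrite /c ltW.
  - by apply: mulr_gt0 => //; apply: mulr_gt0 => //; exact: card_gt0R.
  move=> n Nn Jn; have [nt ts tF [tn|[ltn Ft]]] := Ht n Nn.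
    by left; rewrite /c tn subnn expr0.
  (* By minimality of t, a n <= K F(s n) #D^n <= K G N q^(t - 1) #D^n, which is K G N #D times c
     n. *)
  right; have [sn|h] := as_le Jn; first by move: ts; rewrite sn leqNgt ltn.
  rewrite (le_trans h)// -!mulrA ler_pM2l// /c.
  have -> : G N * (#|D|%:R * q ^+ (t n - n)) = G N * q ^+ (t n).-1 * #|D|%:R ^+ n.
    have -> : (t n).-1 = ((t n - n).-1 + n)%N by clear -ltn; lia.
    have -> : (t n - n)%N = (t n - n).-1.+1 by clear -ltn; lia.
    rewrite exprS exprD/= -!mulrA -exprMn mulVf ?gt_eqF ?card_gt0R//.
    by rewrite expr1n mulr1 [#|D|%:R * _]mulrA divff ?gt_eqF ?card_gt0R// mul1r.
  by rewrite ler_wpM2r ?exprn_ge0// ltW.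
(* A sum above 2 brings the proportion 2 / (S + 2) of words without a run below 1/2. Positions are
   then shifted by N1, since [z] is appended to [u1]. *)
have [M HM] := divc 2 N1.
pose J' k := J (k + N1)%N; pose l' k := (t (k + N1) - (k + N1))%N.
pose M' := (M - N1)%N.
pose Z := (M' + \max_(k < M') (k + l' k))%N.
have lZ n : (n < M')%N -> J' n -> (n + l' n <= Z)%N.
  move=> nM _; apply: (@leq_trans (\max_(k < M') (k + l' k))); last by rewrite leq_addl.
  by rewrite (leq_bigmax (F := fun k : 'I_M' => (k + l' k)%N) (Ordinal nM)).
have := avg_avoid_runs R D2 eD lZ (leq_addr _ _).
have -> : \sum_(0 <= n < M' | J' n) q ^+ l' n = \sum_(N1 <= n < M | J n) c n.
  by rewrite -{1}[N1]add0n big_addn.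
set S := \sum_(N1 <= n < M | J n) c n in HM *; set av := avg _ _ _ => avS.
have {avS} av_lt : av < 2^-1.
  rewrite -(ltr_pM2r (_ : 0 < S + 2)); last by lra.
  by rewrite (le_lt_trans avS)//; lra.
(* As [u1] costs less than a quarter of G N q^N1, this threshold makes the maximal inequality give
   less than 1/2; and a word of length t n that is no hit costs less than F(s n) / 2. *)
pose lam := 2^-1 * G N.
have lam0 : 0 < lam by apply: mulr_gt0; rewrite ?invr_gt0.
have := avg_hits_le D2 Z u1 Phi0 PhiS lam0.
set hh := avg _ _ _ => hle.
have {hle} hh_lt : hh < 2^-1.
  rewrite (le_lt_trans hle)// ltr_pdivrMr ?(mulr_gt0 lam0)// su1 (lt_le_trans u1P)//.
  by rewrite /lam mulrA [leRHS]mulrA; lra.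
have : hh + av < 1 by lra.
rewrite -avgD => /(avg_lt_ex D2)[z]; rewrite mem_words => /andP[/eqP sz zD] H.
have nh := natb_lt1 (ler0n _ _) H.
move: H; rewrite addrC => /(natb_lt1 (ler0n _ _)); rewrite negbK => /hasP[k].
rewrite mem_index_iota /= => kM /andP[Jk rk].
pose n := (k + N1)%N; have N1n : (N1 <= n)%N := leq_addl _ _.
have Nn : (N <= n)%N by rewrite (leq_trans (ltnW NN1)).
have [nt ts tF _] := Ht n Nn.
have kl : (k + l' k = t n - N1)%N by rewrite /l' -/n /n; move: nt; rewrite /n; clear; lia.
have N1t : (N1 <= t n)%N := leq_trans N1n nt.
have tZ : (t n - N1 <= Z)%N by rewrite -kl lZ.
pose w := u1 ++ take (t n - N1) z.
have sw : size w = t n by rewrite size_cat su1 size_takel ?sz// subnKC.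
pose v := w ++ nseq (s n - t n) e.
have sv : size v = s n by rewrite size_cat sw size_nseq subnKC.
have enD m : all [in D] (nseq m e) by elim: m => //= m ->; rewrite eD.
have takeD i : all [in D] (take i z).
  by apply/allP => d /mem_take; apply: (allP zD).
have wD : all [in D] w by rewrite all_cat u1D takeD.
have Pw : Phi w < 2^-1 * (G N * q ^+ t n).
  rewrite ltNge; apply: contra nh => h; apply: (@hits_take _ _ _ _ (t n - N1)).
  by rewrite -/w sw /lam -mulrA.
have Pws : Phi w < 2^-1 * F (s n) by rewrite (lt_le_trans Pw)// ler_pM2l// invr_gt0.
exists v, n; split => //; last first.
- split=> //; rewrite /run /v /w -catA drop_cat su1 ltnNge leq_addl/= /n addnK.
  rewrite drop_cat size_take sz -/n -kl.
  have lk : take (l' k) (drop k z) = nseq (l' k) e.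
    by move: rk; rewrite /run prefixE size_nseq => /eqP.
  have -> : drop k (take (k + l' k) z) = nseq (l' k) e by rewrite addnC -take_drop.
  have -> : (if (k + l' k < Z)%N then (k + l' k)%N else Z) = (k + l' k)%N.
    by case: ltnP => // Zk; apply/eqP; rewrite eqn_leq Zk kl tZ.
  have -> : (s n - n = l' k + (s n - t n))%N by rewrite /l' -/n; clear -nt ts; lia.
  case: ltnP => kk; first by rewrite nseqD prefix_refl.
  have -> : l' k = 0%N by clear -kk; lia.
  by rewrite addn0 subnn drop0 add0n prefix_refl.
- by rewrite sv (leq_trans nt ts) (leq_trans NN1).
- by rewrite (prefix_trans uu1)// /v /w -catA prefix_prefix.
split; first by rewrite all_cat wD enD.
  move=> i; rewrite /v take_cat; case: ltnP => [iw|wi].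
    rewrite /w take_cat; case: ltnP => [_|u1i]; first exact: u1B.
    move: iw; rewrite sw => it.
    rewrite take_takel; last by rewrite su1 leq_sub2r// ltnW.
    move=> B; move/negP: nh; apply; apply: (@hits_take _ _ _ _ (i - size u1)%N).
    have := BadPhi B; rewrite -GF => /(le_trans _); apply.
    rewrite ler_pM2r// /lam (le_trans (y := G N))//.
      by rewrite ler_piMl ?ltW// invf_lt1 ?ltr1n.
    by rewrite Gnd// size_cat su1 (leq_trans (ltnW NN1))// leq_addr.
  (* Prefixes from [w] on cost at most Phi w < F(s n) / 2, which is below F of their length, so they
     are not bad. *)
  have -> : take (i - size w) (nseq (s n - t n) e) = nseq (minn (i - size w) (s n - t n)) e.
    by case: leqP => h; [rewrite take_nseq | rewrite take_oversize// size_nseq ltnW].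
  move=> B; have := BadPhi B.
  apply/negP; rewrite -ltNge (le_lt_trans (superadditive_cat_le _ (enD _)))//.
  rewrite (lt_le_trans Pws)// (le_trans (y := F (s n)))//.
    by rewrite ler_piMl ?ltW// invf_lt1 ?ltr1n.
  by apply: Fni; rewrite size_cat size_nseq sw -leq_subRL// geq_minr.
by rewrite sv (le_lt_trans (superadditive_cat_le _ (enD _))).
Qed.

Lemma limsup_avoiding u0 : good u0 -> exists x : nat -> T,
  [/\ forall i, x i \in D, forall k, ~ Bad (mkseq x k) &
   forall m, exists n, [/\ (m <= n)%N, J n & forall i, (n <= i < s n)%N -> x i = e]].
Proof.
move=> g0.
have /choice[step Hstep] : forall u : {u | good u}, exists v : {v | good v},
    exists n, [/\ prefix (sval u) (sval v), (size (sval u) < n <= size (sval v))%N, J n,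
      size (sval v) = s n & run e n (s n - n) (sval v)].
  move=> [u gu]; have [v [n [gv uv nv Jn [sv rv]]]] := good_extend gu.
  by exists (exist _ v gv), n.
pose v k := sval (iter k step (exist _ u0 g0)).
have vg k : good (v k) by rewrite /v; case: (iter _ _ _).
have vS k : exists n, [/\ prefix (v k) (v k.+1), (size (v k) < n <= size (v k.+1))%N, J n,
      size (v k.+1) = s n & run e n (s n - n) (v k.+1)] := Hstep _.
have vsz k : (k <= size (v k))%N.
  by elim: k => // k IH; have [n [_ /andP[h1 h2] _ _ _]] := vS k; clear -IH h1 h2; lia.
have vpre k m : (k <= m)%N -> prefix (v k) (v m).
  elim: m => [|m IH]; first by rewrite leqn0 => /eqP ->; exact: prefix_refl.
  rewrite leq_eqVlt => /predU1P[->|]; first exact: prefix_refl.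
  by move/IH => h; have [n [h' _ _ _ _]] := vS m; exact: prefix_trans h h'.
have vnth k m i : (i < size (v k))%N -> (k <= m)%N -> nth e (v m) i = nth e (v k) i.
  by move=> iv /vpre/prefixP[z ->]; rewrite nth_cat iv.
(* The words [v k] are nested and have length at least k, so [v i.+1] already fixes the digit
   [i]. *)
pose x i := nth e (v i.+1) i.
have xv k i : (i < size (v k))%N -> x i = nth e (v k) i.
  move=> iv; have [ki|ik] := leqP k i.+1; first exact: vnth.
  by rewrite /x (@vnth i.+1 k) ?vsz// ltnW.
exists x; split.
- move=> i; have [/allP vD _ _] := vg i.+1; apply/vD/mem_nth; exact: vsz.
- move=> k; have [_ + _] := vg k => /(_ k); congr (~ Bad _).
  apply: (@eq_from_nth _ e); rewrite size_takel ?size_mkseq//.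
  by move=> i ik; rewrite nth_take// nth_mkseq// (xv k)// (leq_trans ik).
- move=> m; have [n [_ /andP[h1 h2] Jn sv rv]] := vS m.
  exists n; split=> //; first by rewrite (leq_trans (vsz m))// ltnW.
  move=> i /andP[ni ins]; rewrite (xv m.+1) ?sv//.
  by apply: (run_nth rv); rewrite ni subnKC// sge.
Qed.

End Avoidance.

(** * Subadditivity of the Hausdorff measure *)

Section HausdorffMeasure.
Variables (R : realType) (f : R -> R).
Hypothesis f_gt0 : forall r, 0 < r -> 0 < f r.
Hypothesis f_nd : forall r s, 0 < r -> r <= s -> f r <= f s.
Local Open Scope ereal_scope.

Lemma diam_le (A : set R) (r : R) :
  (forall x y, A x -> A y -> `|x - y| <= r)%R -> diam A <= r%:E.
Proof.
by move=> H; apply: ge_ereal_sup => _ /= [x Ax [y Ay <-]]; rewrite lee_fin H.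
Qed.

Lemma diam_ge (A : set R) x y : A x -> A y -> `|x - y|%:E <= diam A.
Proof. by move=> Ax Ay; apply: ereal_sup_ubound; exists x => //; exists y. Qed.

Lemma diam0 : diam (set0 : set R) = -oo.
Proof.
rewrite /diam -ereal_sup0; congr ereal_sup.
by apply/seteqP; split => // z [x []].
Qed.

Lemma hcontrib_ge0 A : 0 <= hcontrib f A.
Proof.
rewrite /hcontrib; case: (diam A) => // r; case: ifP => // r0.
by rewrite lee_fin ltW// f_gt0.
Qed.

Lemma hcontrib0 : hcontrib f set0 = 0.
Proof. by rewrite /hcontrib diam0. Qed.

Lemma hcontrib_le A r : (0 < r)%R -> diam A <= r%:E -> hcontrib f A <= (f r)%:E.
Proof.
move=> r0; rewrite /hcontrib; case: (diam A) => [t||] tr; rewrite ?lee_fin ?(ltW (f_gt0 _))//.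
by case: ifP => t0; rewrite lee_fin ?f_nd// ltW// f_gt0.
Qed.

(* The content is the outer measure generated by [gauge d] on the sigma-algebra of all
   subsets, so that the library's countable subadditivity applies to it. *)
Let Tall := g_sigma_algebraType [set: set R].
Let gauge d (A : set R) := if diam A <= d%:E then hcontrib f A else +oo.

Let gauge0 d : gauge d set0 = 0.
Proof. by rewrite /gauge diam0 leNye hcontrib0. Qed.

Let gauge_ge0 d A : 0 <= gauge d A.
Proof. by rewrite /gauge; case: ifP => // _; exact: hcontrib_ge0. Qed.

Let hausdorff_contentE d A : hausdorff_content f d A = mu_ext (T := Tall) (gauge d) A.
Proof.
apply/eqP; rewrite eq_le; apply/andP; split; apply: le_ereal_inf_tmp.
  move=> _ /= [U [mU AU] <-].
  (* A cover with a set of diameter above [d] has infinite total gauge and does not lower the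
     infimum. *)
  have [[k Uk]|H] := pselect (exists k, ~~ (diam (U k) <= d%:E)).
    rewrite (eseries_pinfty (k := k)) ?leey//.
      by move=> n _; rewrite -ltNye (lt_le_trans _ (gauge_ge0 _ _)).
    by rewrite /gauge (negbTE Uk).
  have {}H k : diam (U k) <= d%:E by apply: contra_notT H => ?; exists k.
  apply: ereal_inf_lbound; exists U => //.
  by apply: eq_eseriesr => k _; rewrite /gauge H.
move=> _ /= [U [AU dU] <-]; apply: ereal_inf_lbound; exists U.
  by split=> // k; exact: sub_sigma_algebra.
by apply: eq_eseriesr => k _; rewrite /gauge dU.
Qed.

Lemma le_hausdorff_content d : {homo hausdorff_content f d : A B / A `<=` B >-> A <= B}.
Proof. by move=> A B AB; rewrite !hausdorff_contentE; exact: le_mu_ext. Qed.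

Lemma hausdorff_content_ge0 d A : 0 <= hausdorff_content f d A.
Proof. rewrite hausdorff_contentE; exact: mu_ext_ge0. Qed.

Lemma hausdorff_content0 d : hausdorff_content f d set0 = 0.
Proof. by rewrite hausdorff_contentE; exact: mu_ext0. Qed.

Lemma hausdorff_content_sigma_subadditive d (A : nat -> set R) :
  hausdorff_content f d (\bigcup_n A n) <= \sum_(n <oo) hausdorff_content f d (A n).
Proof.
rewrite hausdorff_contentE; under eq_eseriesr do rewrite hausdorff_contentE.
exact: mu_ext_sigma_subadditive.
Qed.

Lemma hausdorff_content_seq (I : eqType) (s : seq I) (A : I -> set R) (d r : R) :
  (0 < r)%R -> (r <= d)%R -> (forall i, i \in s -> diam (A i) <= r%:E) ->
  hausdorff_content f d [set x | exists2 i, i \in s & A i x] <= (f r *+ size s)%:E.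
Proof.
move=> r0 rd Ar; case: s Ar => [|i0 s'] Ar.
  rewrite -[leRHS](hausdorff_content0 d).
  by apply: le_hausdorff_content => x [].
set s := i0 :: s' in Ar *.
pose U k := if (k < size s)%N then A (nth i0 s k) else set0.
apply: (@le_trans _ _ (\sum_(0 <= k <oo) hcontrib f (U k))).
  apply: ereal_inf_lbound; exists U => //; split.
    move=> x [i /(nthP i0)[k ks <-] Ax]; exists k => //; by rewrite /U ks.
  move=> k; rewrite /U; case: ifP => ks; last by rewrite diam0 leNye.
  by rewrite (le_trans (Ar _ (mem_nth _ ks)))// lee_fin.
rewrite (nneseries_split 0 (size s)); last by move=> k _; exact: hcontrib_ge0.
rewrite add0n [X in _ + X]eseries0 ?adde0; last first.
  by move=> k + _; rewrite leqNgt /U => /negbTE->; exact: hcontrib0.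
rewrite -[X in (f r *+ X)%:E]subn0 -sumr_const_nat -sumEFin.
rewrite big_nat [leRHS]big_nat; apply: lee_sum => k /andP[_ ks].
rewrite /U ks; apply: hcontrib_le => //; exact/Ar/mem_nth.
Qed.

Lemma le_hausdorff_measure : {homo hausdorff_measure f : A B / A `<=` B >-> A <= B}.
Proof.
move=> A B AB; apply: ge_ereal_sup => _ [d /= d0 <-].
rewrite (le_trans (le_hausdorff_content d AB))//.
by apply: ereal_sup_ubound; exists d.
Qed.

Lemma hausdorff_measure_le A x :
  (forall d, (0 < d)%R -> hausdorff_content f d A <= x) -> hausdorff_measure f A <= x.
Proof. by move=> H; apply: ge_ereal_sup => _ [d /= d0 <-]; exact: H. Qed.

Lemma hausdorff_measure_ge0 A : 0 <= hausdorff_measure f A.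
Proof.
apply: le_trans (hausdorff_content_ge0 1 A) _.
by apply: ereal_sup_ubound; exists 1%R => //=.
Qed.

Lemma hausdorff_measure_sigma_subadditive (A : nat -> set R) :
  hausdorff_measure f (\bigcup_n A n) <= \sum_(n <oo) hausdorff_measure f (A n).
Proof.
apply: hausdorff_measure_le => d d0.
apply: le_trans (hausdorff_content_sigma_subadditive _ _) _.
apply: lee_nneseries => n *; first exact: hausdorff_content_ge0.
by apply: ereal_sup_ubound; exists d.
Qed.

Lemma hausdorff_measure_setUnull A (N : nat -> set R) :
  (forall n, hausdorff_measure f (N n) = 0) ->
  hausdorff_measure f (A `|` \bigcup_n N n) <= hausdorff_measure f A.
Proof.
move=> N0; pose B n := if n is n'.+1 then N n' else A.
have -> : A `|` \bigcup_n N n = \bigcup_n B n.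
  apply/seteqP; split=> [x [Ax|[n _ Nx]]|x [[|n] _ Bx]].
  - by exists 0%N.
  - by exists n.+1.
  - by left.
  - by right; exists n.
apply: (le_trans (hausdorff_measure_sigma_subadditive _)).
rewrite (nneseries_split 0 1); last by move=> k _; exact: hausdorff_measure_ge0.
rewrite add0n big_nat1 [X in _ + X]eseries0 ?adde0//.
by move=> [|n]//= _ _; rewrite /B N0.
Qed.

End HausdorffMeasure.

(** * Base-b expansions *)

Section Expansion.
Variables (R : realType) (b : nat).
Hypothesis b2 : (2 <= b)%N.

Definition expands (a : nat -> 'I_b) (x : R) :=
  series (fun n => (val (a n))%:R / (b%:R ^+ n.+1)) @ \oo --> x.

(* The integer p such that the cylinder of w is [p / b^|w|, (p + 1) / b^|w|]. *)
Definition wnum (w : seq 'I_b) : nat := foldl (fun p (d : 'I_b) => (p * b + d)%N) 0%N w.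

Lemma wnum_rcons w d : wnum (rcons w d) = (wnum w * b + d)%N.
Proof. by rewrite /wnum foldl_rcons. Qed.

Lemma wnum_inj v w : size v = size w -> wnum v = wnum w -> v = w.
Proof.
elim/last_ind: v w => [|v d IH] w; first by move/esym/size0nil->.
case/lastP: w => [|w d']; first by rewrite size_rcons.
rewrite !size_rcons !wnum_rcons => -[sz] H.
have dE : d = d' :> nat.
  have := congr1 (modn^~ b) H; by rewrite !modnMDl !modn_small.
move: H; rewrite dE => /addIn/eqP; rewrite eqn_mul2r; case/orP => [|/eqP /IH ->//].
  by rewrite -leqn0 leqNgt (ltnW b2).
by congr rcons; exact: val_inj.
Qed.

Lemma base_gt0 : 0 < b%:R :> R.
Proof. by rewrite ltr0n (leq_trans _ b2). Qed.

Lemma baseB1_gt0 : 0 < b%:R - 1 :> R.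
Proof. by rewrite subr_gt0 ltr1n. Qed.

Local Notation bn n := ((b%:R : R) ^+ n).

Lemma baseX_gt0 n : 0 < bn n.
Proof. by rewrite exprn_gt0// base_gt0. Qed.

Lemma ltn_baseX n : (n%:R : R) < bn n.
Proof. by rewrite -natrX ltr_nat ltn_expl. Qed.

Lemma baseXV_small (r : R) : 0 < r -> exists n, (bn n)^-1 < r.
Proof.
move=> r0; exists (Num.bound r^-1).
rewrite -[ltRHS]invrK ltf_pV2 ?posrE ?baseX_gt0 ?invr_gt0//.
by rewrite (lt_trans _ (ltn_baseX _))// archi_boundP// invr_ge0 ltW.
Qed.

Lemma expands_shift a x : expands a x -> expands (fun n => a n.+1) (b%:R * x - (a 0%N)%:R).
Proof.
move=> ax; rewrite /expands.
set u := fun n => (val (a n))%:R / bn n.+1 in ax *.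
rewrite (_ : series _ = fun n => b%:R * series u n.+1 - (a 0%N)%:R).
  by apply: cvgB; [apply: cvgMl_tmp; rewrite cvg_shiftS | exact: cvg_cst].
apply/funext => n; rewrite /series/= big_nat_recl//= mulrDr /u expr1.
rewrite [X in X + _ - _]mulrC divfK ?gt_eqF ?base_gt0// addrAC subrr add0r mulr_sumr.
apply: eq_bigr => i _; rewrite [bn i.+2]exprS invfM mulrCA.
by rewrite [b%:R * _]mulrA divff ?gt_eqF ?base_gt0// mul1r.
Qed.

(** Self-similarity: [y] is the n-th shift of [x], so estimates at level n reduce to points of the
    unit interval scaled by b^-n. *)
Lemma expands_tail a x n : expands a x ->
  exists2 y, expands (fun k => a (n + k)%N) y & x = ((wnum (mkseq a n))%:R + y) / bn n.
Proof.
move=> ax; elim: n => [|n [y ay ->]]; first by exists x; rewrite // add0r expr0 divr1.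
exists (b%:R * y - (a n)%:R).
  by have := expands_shift ay; under eq_fun do rewrite addnS; rewrite addn0.
rewrite mkseqS wnum_rcons natrD natrM exprS invfM mulrA; congr (_ / _).
by rewrite addrACA subrr addr0 [b%:R * y]mulrC -mulrDl mulfK// gt_eqF// base_gt0.
Qed.

Let geo (c : R) : [sequence c / (b%:R - 1) * (1 - (bn n)^-1)]_n @ \oo --> c / (b%:R - 1).
Proof.
rewrite -[X in _ --> X]mulr1; apply: cvgMl_tmp.
rewrite -[X in _ --> X]subr0; apply: cvgB; first exact: cvg_cst.
have := @cvg_geometric R 1 b%:R^-1.
rewrite ger0_norm ?invr_ge0 ?ler0n// invf_lt1 ?base_gt0// ltr1n => /(_ b2).
by rewrite /geometric/=; under eq_fun do rewrite mul1r exprVn.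
Qed.

Let geo_sum (c : R) n : c / (b%:R - 1) * (1 - (bn n)^-1) = \sum_(0 <= k < n) c / bn k.+1.
Proof.
elim: n => [|n IH]; first by rewrite big_geq// expr0 invr1 subrr mulr0.
rewrite big_nat_recr//= -IH exprS.
have := baseX_gt0 n; have := base_gt0; have := baseB1_gt0.
move: (bn n) (b%:R : R) => p B B1 B0 p0.
by field; rewrite !gt_eqF.
Qed.

Lemma expands_bounds a x lo hi : expands a x ->
  (forall n, (lo <= a n <= hi)%N) -> lo%:R / (b%:R - 1) <= x <= hi%:R / (b%:R - 1).
Proof.
rewrite /expands => ax H; apply/andP; split.
  apply: (ler_cvg_to (@geo lo%:R) ax); near=> n.
  rewrite /= geo_sum ler_sum// => k _; rewrite ler_pM2r ?invr_gt0 ?baseX_gt0// ler_nat.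
  by case/andP: (H k).
apply: (ler_cvg_to ax (@geo hi%:R)); near=> n.
rewrite /= geo_sum ler_sum// => k _; rewrite ler_pM2r ?invr_gt0 ?baseX_gt0// ler_nat.
by case/andP: (H k).
Unshelve. all: by end_near. Qed.

Lemma expands_const d : expands (fun=> d) ((val d)%:R / (b%:R - 1)).
Proof.
rewrite /expands (_ : series _ = [sequence (val d)%:R / (b%:R - 1) * (1 - (bn n)^-1)]_n).
  exact: geo.
by apply/funext => n /=; rewrite geo_sum.
Qed.

Lemma expands01 a x : expands a x -> 0 <= x <= 1.
Proof.
move=> ax; have /(expands_bounds ax)/andP[] : forall n, (0 <= a n <= b.-1)%N.
  by move=> n /=; rewrite -ltnS prednK// (leq_trans _ b2).
by rewrite mul0r -subn1 natrB ?(ltnW b2)// divff ?gt_eqF ?baseB1_gt0// => -> ->.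
Qed.

Lemma expands_exists a : exists x, expands a x.
Proof.
set u := fun n => (val (a n))%:R / bn n.+1.
have u0 n : 0 <= u n by rewrite divr_ge0// ltW// baseX_gt0.
suff : cvg (series u @ \oo) by move=> ?; exists (limn (series u)).
apply: nondecreasing_is_cvgn; first by apply: nondecreasing_series => n *; exact: u0.
exists 1 => _ [n _ <-].
apply: (@le_trans _ _ (\sum_(0 <= k < n) (b%:R - 1) / bn k.+1)).
  rewrite ler_sum// => k _; rewrite ler_pM2r ?invr_gt0 ?baseX_gt0//.
  by rewrite lerBrDr natr1 ler_nat ltn_ord.
by rewrite -geo_sum divff ?gt_eqF ?baseB1_gt0// mul1r lerBlDr lerDl invr_ge0 exprn_ge0.
Qed.

Lemma expands_close a a' x x' n : expands a x -> expands a' x' ->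
  (forall k, (k < n)%N -> a k = a' k) -> `|x - x'| <= (bn n)^-1.
Proof.
move=> /expands_tail-/(_ n)[y /expands01 y01 ->] /expands_tail-/(_ n)[y' /expands01 y'01 ->] aa'.
have -> : mkseq a n = mkseq a' n.
  by apply/eq_in_map => k; rewrite mem_iota add0n => /andP[_ /aa'].
rewrite -mulrBl normrM normfV (ger0_norm (ltW (baseX_gt0 n))) -[leRHS]mul1r.
by rewrite ler_pM2r ?invr_gt0 ?baseX_gt0// ler_norml; lra.
Qed.

End Expansion.

Lemma bigminn_le (I : eqType) (r : seq I) (P : pred I) (F : I -> nat) x i :
  i \in r -> P i -> (\big[minn/x]_(j <- r | P j) F j <= F i)%N.
Proof.
elim: r => // j r IH; rewrite inE big_cons => /predU1P[<-{j} Pi|ir Pi].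
  by rewrite Pi geq_minl.
by case: ifP => _; rewrite ?(leq_trans (geq_minr _ _)) ?IH.
Qed.

Lemma bigminn_attained (I : eqType) (r : seq I) (P : pred I) (F : I -> nat) x :
  \big[minn/x]_(j <- r | P j) F j = x \/
  exists2 i, P i & \big[minn/x]_(j <- r | P j) F j = F i.
Proof.
elim: r => [|j r IH]; first by left; rewrite big_nil.
rewrite big_cons; case: ifP => // Pj; case: (leqP (F j)) => _ //.
by right; exists j.
Qed.

(** * Distance from the Cantor set to the fractions p / b^n *)

Section DigitGap.
Variables (R : realType) (b : nat) (D : {set 'I_b}).
Hypotheses (b2 : (2 <= b)%N) (D0 : (0 < #|D|)%N).

Lemma digit_gap_bounds d : d \in D -> (digit_gap D <= d <= b.-1 - digit_gap D)%N.
Proof.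
move=> dD; have h1 : (\big[minn/b]_(i in D) val i <= d)%N.
  by apply: bigminn_le; rewrite ?mem_index_enum.
have h2 : (d <= \max_(i in D) val i)%N by exact: leq_bigmax_cond.
have h3 : (\max_(i in D) val i <= b.-1)%N.
  by apply/bigmax_leqP => i _; rewrite -ltnS (ltn_predK b2) ltn_ord.
by rewrite /digit_gap; move: h1 h2 h3; move: (bigop _ _ _) (bigop _ _ _) (val d) (b.-1); clear; lia.
Qed.

Notation c := ((digit_gap D)%:R / (b%:R - 1) : R).
Notation bn n := ((b%:R : R) ^+ n).

(* The boolean o selects the left (0) or right (1) end of the unit interval. *)
Lemma digit_gap_attained : exists e (o : bool),
  e \in D /\ `|o%:R - (val e)%:R / (b%:R - 1)| = c.
Proof.
have B0 := baseB1_gt0 R b2.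
set lo := \big[minn/b]_(i in D) val i; set hi := \max_(i in D) val i.
(* The number e / (b - 1) has all digits equal to e. The gap is realised by the least digit at the
   left end or by the greatest digit at the right end. *)
have [loP|loP] := leqP lo (b.-1 - hi)%N.
  have [d dD] : exists d, d \in D by apply/card_gt0P.
  have [lob|[e eD loe]] := bigminn_attained (index_enum 'I_b) (mem D) val b.
    (* The default value [b] of the minimum exceeds every digit, so it is not attained. *)
    have : (lo <= d)%N by apply: bigminn_le; rewrite ?mem_index_enum.
    by rewrite /lo lob leqNgt ltn_ord.
  exists e, false; split=> //; rewrite /digit_gap -/lo -/hi (minn_idPl loP) /lo loe.
  by rewrite sub0r normrN ger0_norm// divr_ge0// ltW.
have [e eD hie] := eq_bigmax_cond val D0.
exists e, true; split=> //; rewrite /digit_gap -/lo -/hi (minn_idPr (ltnW loP)).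
have eb : (e <= b.-1)%N by rewrite -ltnS (ltn_predK b2) ltn_ord.
rewrite /hi hie natrB// -subn1 natrB ?(ltnW b2)//.
rewrite -{1}[1](divff (lt0r_neq0 B0)) -mulrBl ger0_norm// divr_ge0 ?(ltW B0)//.
by rewrite subr_ge0 lerBrDr natr1 ler_nat ltn_ord.
Qed.

(** [c] is the number whose digits all equal the gap, and 1 - c the one whose digits all equal b - 1
    minus the gap; digitwise comparison gives the bounds. *)
Lemma expands_gap a y : (forall n, a n \in D) -> expands a y -> c <= y <= 1 - c.
Proof.
move=> aD ay; have := expands_bounds b2 ay (fun n => digit_gap_bounds (aD n)).
have [d dD] : exists d, d \in D by apply/card_gt0P.
have /andP[h1 h2] := digit_gap_bounds dD.
have -> : (b.-1 - digit_gap D)%:R / (b%:R - 1) = 1 - c; last by [].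
rewrite natrB; last by rewrite (leq_trans h1)// (leq_trans h2)// leq_subr.
by rewrite -subn1 natrB ?(ltnW b2)// mulrBl divff// lt0r_neq0// baseB1_gt0.
Qed.

(** With [e] repeated forever after level n, the point would lie at distance exactly c b^-n from the
    chosen end; agreement with it only up to digit [s] costs another b^-s. *)
Lemma run_badic_close (a : nat -> 'I_b) (x : R) n s e (o : bool) : expands a x -> (n <= s)%N ->
  (forall k, (n <= k < s)%N -> a k = e) -> `|o%:R - (val e)%:R / (b%:R - 1)| = c ->
  `|x - (wnum (mkseq a n) + o)%:R / bn n| <= c / bn n + (bn s)^-1.
Proof.
move=> ax ns ae oc; have [y ay ->] := expands_tail b2 n ax.
have t0 : 0 < (bn n)^-1 by rewrite invr_gt0 baseX_gt0.
have yz : `|y - (val e)%:R / (b%:R - 1)| <= (bn (s - n))^-1.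
  apply: (expands_close b2 ay (@expands_const R b b2 e)) => k ks.
  by rewrite ae// leq_addr/= -ltn_subRL.
rewrite -mulrBl natrD opprD addrACA subrr add0r normrM (ger0_norm (ltW t0)).
have -> : (bn s)^-1 = (bn (s - n))^-1 * (bn n)^-1.
  by rewrite -invfM -exprD subnK.
rewrite -mulrDl ler_pM2r// -oc.
have := ler_distD ((val e)%:R / (b%:R - 1)) y o%:R.
by rewrite [`|_ / _ - o%:R|]distrC; lra.
Qed.

(** A fraction other than the two ends of the level-n cylinder of [x] is at distance at least (1 +
    c) b^-n from [x], which forces r - c b^-n >= b^-n. The ends themselves are at distance at least
    c b^-n. *)
Lemma badic_close (a : nat -> 'I_b) (x : R) n p r : (forall n, a n \in D) -> expands a x ->
  `|x - p%:R / bn n| < r ->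
  c / bn n < r /\ ((bn n)^-1 <= r - c / bn n \/ exists o : bool, p = (wnum (mkseq a n) + o)%N).
Proof.
move=> aD ax; have [y ay xE] := expands_tail b2 n ax.
have /andP[] := expands_gap (fun k => aD (n + k)%N) ay.
have t0 : 0 < (bn n)^-1 by rewrite invr_gt0 baseX_gt0.
rewrite xE -mulrBl normrM (ger0_norm (ltW t0)).
move: (bn n)^-1 t0 c (wnum (mkseq a n)) => t t0 C W Cy yC.
move=> Wpr; have key K : K <= `|W%:R + y - p%:R| -> K * t < r.
  by move=> h; rewrite (le_lt_trans _ Wpr)// ler_wpM2r// ltW.
have [pW|Wp] := leqP p W.
  have : (p%:R : R) <= W%:R by rewrite ler_nat.
  have [pE|pnW] := eqVneq p W => pWR.
    split; last by right; exists false; rewrite pE addn0.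
    by apply: key; rewrite ler_normr pE; apply/orP; left; lra.
  have {}pWR : (p%:R : R) + 1 <= W%:R by rewrite natr1 ler_nat ltn_neqAle pnW.
  have : (1 + C) * t < r by apply: key; rewrite ler_normr; apply/orP; left; lra.
  by split; [|left]; nra.
have : (W%:R : R) + 1 <= p%:R by rewrite natr1 ler_nat.
have [pE|pnW] := eqVneq p W.+1 => pWR.
  split; last by right; exists true; rewrite pE addn1.
  by apply: key; rewrite ler_normr pE; apply/orP; right; rewrite -natr1; lra.
have {}pWR : (W%:R : R) + 2 <= p%:R.
  by rewrite -natrD ler_nat addn2 ltn_neqAle eq_sym pnW.
have : (1 + C) * t < r by apply: key; rewrite ler_normr; apply/orP; right; lra.
by split; [|left]; nra.
Qed.

(** Points of one cylinder lie on the same side of its end, at distances between c b^-n and r, so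
    they differ by at most the length of that range. *)
Lemma badic_close_diam (a a' : nat -> 'I_b) (x x' : R) n (o : bool) r :
  (forall n, a n \in D) -> (forall n, a' n \in D) -> expands a x -> expands a' x' ->
  mkseq a n = mkseq a' n ->
  `|x - (wnum (mkseq a n) + o)%:R / bn n| < r -> `|x' - (wnum (mkseq a n) + o)%:R / bn n| < r ->
  `|x - x'| <= r - c / bn n.
Proof.
move=> aD aD' /(expands_tail b2 n)[y ay ->] /(expands_tail b2 n)[y' ay' ->] <-.
have t0 : 0 < (bn n)^-1 by rewrite invr_gt0 baseX_gt0.
have := expands_gap (fun k => aD' (n + k)%N) ay'.
have := expands_gap (fun k => aD (n + k)%N) ay.
move: (bn n)^-1 t0 c (wnum (mkseq a n)) => t t0 C W /andP[Cy yC] /andP[Cy' yC'].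
have yt z : C <= z -> C * t <= z * t by rewrite ler_pM2r.
have ty z : z <= 1 - C -> z * t <= t - C * t.
  by move=> h; rewrite -[X in X - _]mul1r -mulrBl ler_pM2r.
have := yt _ Cy; have := yt _ Cy'; have := ty _ yC; have := ty _ yC'.
rewrite natrD !mulrDl.
by case: o => /=; rewrite ?mul1r ?mul0r !ltr_norml !ler_norml; lra.
Qed.

End DigitGap.

(** * The convergent case *)

Section Series.
Variables (R : realType) (P : pred nat).

Lemma nneseries_tail_lt (u : nat -> \bar R) m (e : R) N0 :
  (forall n, P n -> (0 <= u n)%E) -> (\sum_(m <= n <oo | P n) u n < +oo)%E -> 0 < e ->
  exists N, (N0 <= N)%N /\ (\sum_(N <= n <oo | P n) u n < e%:E)%E.
Proof.
move=> u0; rewrite eseries_cond => Soo e0.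
have u0' k : P k && (m <= k)%N -> (0 <= u k)%E by case/andP => /u0.
have [N _ HN] := nneseries_tail_cvg Soo u0' (nbhs_open_ereal_lt (f := fun=> e) e0).
exists (maxn N (maxn N0 m)); split; first by rewrite !leq_max leqnn orbT.
have := HN (maxn N (maxn N0 m)) (leq_maxl _ _) => /=.
apply: le_lt_trans; rewrite eseries_cond [leRHS]eseries_cond.
rewrite le_eqVlt; apply/orP; left; apply/eqP/eq_eseriesl => n.
by rewrite -andbA; congr (_ && _); rewrite !geq_max; case: (m <= n)%N; rewrite ?andbT ?andbF.
Qed.

Lemma nneseries_diverges (a : nat -> R) m : (forall n, P n -> 0 <= a n) ->
  (\sum_(m <= n <oo | P n) (a n)%:E = +oo)%E -> diverges P a.
Proof.
move=> a0 Soo B N; apply: contrapT => H.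
have {}H M : \sum_(N <= n < M | P n) a n <= B.
  by rewrite leNgt; apply/negP => h; apply: H; exists M.
pose K := maxn m N; pose A := \sum_(m <= n < K | P n) a n.
suff : (\sum_(m <= n <oo | P n) (a n)%:E <= (A + B)%:E)%E by rewrite Soo leye_eq.
apply: lime_le; first by apply: is_cvg_nneseries_cond => n _ /a0; rewrite lee_fin.
near=> M; rewrite sumEFin lee_fin (big_cat_nat (n := K)) ?leq_maxl//=; last by near: M; exists K.
by rewrite lerD2l (le_trans _ (H M))// sum_nat_le_widen// leq_maxr.
Unshelve. all: by end_near. Qed.

End Series.

Section PowR.
Variable R : realType.

Lemma powR_log (b N n : nat) : (2 <= b)%N -> (1 <= N)%N ->
  (b%:R : R) `^ (n%:R * (ln N%:R / ln b%:R)) = N%:R ^+ n.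
Proof.
move=> b2 N1; have b0 : 0 < b%:R :> R by rewrite ltr0n (leq_trans _ b2).
rewrite mulrC powRrM powR_mulrn ?powR_ge0//; congr (_ ^+ _).
rewrite /powR gt_eqF// divfK ?lnK// ?posrE ?ltr0n//.
by rewrite gt_eqF// ln_gt0// ltr1n.
Qed.

End PowR.

Section Setting.
Variables (R : realType) (b : nat) (D : {set 'I_b}) (f : R -> R) (psi : nat -> R).
Hypotheses (b2 : (2 <= b)%N) (D2 : (2 <= #|D|)%N).
Hypothesis f_gt0 : forall r, 0 < r -> 0 < f r.
Hypothesis f_nd : forall r s, 0 < r -> r <= s -> f r <= f s.

Notation bn n := ((b%:R : R) ^+ n).
Notation c := ((digit_gap D)%:R / (b%:R - 1) : R).
Notation C := (@cantor_set R b D).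
Notation W := (W_set b psi).
Let r n := psi n - c / bn n.
Let J n := c / bn n < psi n.
Let a n := f (r n) * #|D|%:R ^+ n.

Let D0 : (0 < #|D|)%N := ltnW D2.
Let r_gt0 n : J n -> 0 < r n. Proof. by rewrite subr_gt0. Qed.
Let bnV_gt0 n : 0 < (bn n)^-1. Proof. by rewrite invr_gt0 baseX_gt0. Qed.

(** For fixed n only finitely many p satisfy the inequality with x in [0,1], so infinitely many
    pairs force unbounded levels. [K n] bounds those p. *)
Let infinite_levels x N : W x -> exists p n, (N <= n)%N /\ `|x - p%:R / bn n| < psi n.
Proof.
move=> [/andP[x0 x1] infx]; apply: contrapT => H; apply: infx.
pose K n := Num.bound (bn n * (1 + `|psi n|)).
apply: (@sub_finite_set _ _ (`I_(\sum_(n < N) K n) `*` `I_N)); last first.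
  by apply: finite_setX; exact: finite_II.
move=> [p n] /= Hpn; have nN : (n < N)%N.
  by rewrite ltnNge; apply/negP => Nn; apply: H; exists p, n.
split=> //=; apply: (@leq_trans (K n)); last first.
  by rewrite (bigD1 (Ordinal nN))//= leq_addr.
rewrite -(ltr_nat R); apply: (le_lt_trans _ (archi_boundP _)); last first.
  by rewrite mulr_ge0 ?(ltW (baseX_gt0 _ _ _))// addr_ge0.
rewrite -ler_pdivrMl ?baseX_gt0// mulrC.
by move: Hpn; rewrite ltr_norml; have := ler_norm (psi n); lra.
Qed.

(* When r n >= b^-n the whole cylinder is taken, its diameter being at most r n. *)
Let piece n (i : seq 'I_b * bool) := [set x : R | exists a, [/\ forall k, a k \in D, expands a x,
  mkseq a n = i.1 & (bn n)^-1 <= r n \/ `|x - (wnum i.1 + i.2)%:R / bn n| < psi n]].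

Let pieces n := [seq (w, o) | w <- words D n, o <- [:: false; true]].

Lemma mkseq_words (x : nat -> 'I_b) n : (forall k, x k \in D) -> mkseq x n \in words D n.
Proof.
by move=> xD; rewrite mem_words size_mkseq eqxx; apply/allP => _ /mapP[k _ ->].
Qed.

Let diam_piece n i : J n -> (diam (piece n i) <= (Num.min (r n) (bn n)^-1)%:E)%E.
Proof.
move=> Jn; apply: diam_le => x y [a1 [a1D a1x w1 h1]] [a2 [a2D a2y w2 h2]].
have xy : `|x - y| <= (bn n)^-1.
  apply: (expands_close b2 a1x a2y) => k kn.
  have := congr1 (fun w => nth (a1 k) w k) (etrans w1 (esym w2)).
  by rewrite !nth_mkseq.
rewrite le_min xy andbT; case: h1 h2 => [h1 _|h1 [h2|h2]]; try exact: le_trans xy _.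
by apply: (badic_close_diam b2 D0 (o := i.2) a1D a2D a1x a2y); rewrite ?w1 ?w2.
Qed.

Let limsup_sub_pieces N : W `&` C `<=`
  \bigcup_n [set x | [/\ (N <= n)%N, J n & exists2 i, i \in pieces n & piece n i x]].
Proof.
move=> x [Wx [a1 [a1D a1x]]]; have [p [n [Nn h]]] := infinite_levels N Wx.
have [Jn side] := badic_close b2 D0 a1D a1x h.
exists n => //; split=> //; case: side => [h'|[sd pE]].
  exists (mkseq a1 n, false); last by exists a1; split => //; left.
  by apply/allpairsP; exists (mkseq a1 n, false); rewrite mkseq_words.
exists (mkseq a1 n, sd); last by exists a1; split => //; right; rewrite -pE.
by apply/allpairsP; exists (mkseq a1 n, sd); rewrite mkseq_words//; case: (sd).
Qed.

Lemma hausdorff_measure_limsup0 : (\sum_(1 <= n <oo | J n) (a n)%:E < +oo)%E ->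
  hausdorff_measure f (W `&` C) = 0%E.
Proof.
move=> Soo; apply/eqP; rewrite eq_le hausdorff_measure_ge0// andbT.
apply: hausdorff_measure_le => d d0; apply/lee_addgt0Pr => e e0; rewrite add0e.
have a0 n : J n -> (0 <= (a n)%:E)%E.
  by move=> Jn; rewrite lee_fin mulr_ge0 ?exprn_ge0// ltW// f_gt0// r_gt0.
have [N0 N0d] := baseXV_small b2 d0.
(* The tail is taken below e / 2 because each word gives two pieces, one for each end of its
   cylinder. *)
have [N [N0N HN]] := nneseries_tail_lt N0 a0 Soo (divr_gt0 e0 (ltr0n _ 2)).
pose B n := [set x | [/\ (N <= n)%N, J n & exists2 i, i \in pieces n & piece n i x]].
apply: le_trans (le_hausdorff_content f_gt0 d (@limsup_sub_pieces N)) _.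
apply: le_trans (hausdorff_content_sigma_subadditive f_gt0 d B) _.
apply: (@le_trans _ _ (\sum_(0 <= n <oo | J n && (N <= n)%N) (2%:E * (a n)%:E)))%E.
  rewrite [leRHS]eseries_mkcond; apply: lee_nneseries => n *; first exact: hausdorff_content_ge0.
  case: ifP => [/andP[Jn Nn]|JN]; last first.
    rewrite (_ : B n = set0) ?hausdorff_content0//.
    by apply/seteqP; split => // x [Nn Jn _]; move: JN; rewrite Jn Nn.
  have rn0 := r_gt0 Jn.
  (* The minimum with b^-n keeps the diameters at most [d] even where [r n] is large. *)
  have m0 : 0 < Num.min (r n) (bn n)^-1 by rewrite lt_min rn0 bnV_gt0.
  apply: (@le_trans _ _ (f (Num.min (r n) (bn n)^-1) *+ size (pieces n))%:E).
    apply: (le_trans (le_hausdorff_content f_gt0 d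
      (_ : _ `<=` [set x | exists2 i, i \in pieces n & piece n i x]))).
      by move=> x [].
    apply: hausdorff_content_seq => //; last by move=> i _; exact: diam_piece.
    apply: (@le_trans _ _ (bn n)^-1); first by rewrite ge_min lexx orbT.
    rewrite (le_trans _ (ltW N0d))// lef_pV2 ?posrE ?baseX_gt0//.
    by rewrite ler_eXn2l ?ltr1n// (leq_trans N0N).
  rewrite size_allpairs size_words /= -EFinM lee_fin -[leLHS]mulr_natl natrM natrX /a.
  rewrite [_ * 2]mulrC -mulrA ler_pM2l// mulrC ler_wpM2r ?exprn_ge0//.
  by rewrite f_nd// ge_min lexx.
rewrite nneseriesZl; last by move=> n /andP[/a0].
rewrite -eseries_cond; apply: (le_trans (lee_wpmul2l _ (ltW HN))) => //.
by rewrite -EFinM lee_fin mulrCA divff ?mulr1// .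
Qed.

End Setting.

(** * The divergent case *)

Section SuperadditiveSeries.
Variables (R : realType) (T : finType) (D : {set T}).

Lemma superadditive_sum_words (phi : seq T -> R) n u :
  (forall w, \sum_(d in D) phi (rcons w d) <= phi w) ->
  \sum_(w <- words D n) phi (u ++ w) <= phi u.
Proof.
move=> phiS; elim: n u => [|n IH] u; first by rewrite big_seq1 cats0.
rewrite big_wordsS; apply: (le_trans _ (phiS u)); apply: ler_sum => d _.
by under eq_bigr do rewrite -cat_rcons; exact: IH.
Qed.

Variables (phi : nat -> seq T -> R) (k : nat -> nat) (beta : nat -> R) (B : R).
Hypotheses (phi0 : forall i w, 0 <= phi i w)
  (phiS : forall i w, \sum_(d in D) phi i (rcons w d) <= phi i w)
  (phi_beta : forall i w, phi i w <= beta i)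
  (phi_supp : forall i w, (k i < size w)%N -> phi i w = 0)
  (betaB : forall n, \sum_(0 <= i < n) beta i <= B).

(** [Phi] is the sum of the [phi i], dominated by the convergent sum of [beta]. On a deep level the
    first terms vanish, and superadditivity bounds the others by a tail of [beta], so the total cost
    of a level tends to 0. *)
Lemma superadditive_series : exists Phi : seq T -> R,
  [/\ forall w, 0 <= Phi w, forall w, \sum_(d in D) Phi (rcons w d) <= Phi w,
      forall i w, phi i w <= Phi w, Phi [::] <= B &
      forall eps, 0 < eps ->
        exists K, forall m, (K <= m)%N -> \sum_(w <- words D m) Phi w < eps].
Proof.
have beta0 i : 0 <= beta i := le_trans (phi0 i [::]) (phi_beta i [::]).
have phi0e i w : (0 <= (phi i w)%:E)%E by rewrite lee_fin.
have beta0e i : (0 <= (beta i)%:E)%E by rewrite lee_fin.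
have sbeta : (\sum_(0 <= i <oo) (beta i)%:E <= B%:E)%E.
  apply: lime_le; first by apply: is_cvg_nneseries => *.
  by near=> n; rewrite sumEFin lee_fin.
have sphi w : (\sum_(0 <= i <oo) (phi i w)%:E <= B%:E)%E.
  by apply: le_trans sbeta; apply: lee_nneseries => *; rewrite ?lee_fin.
pose Phi w := fine (\sum_(0 <= i <oo) (phi i w)%:E)%E.
have PhiE w : (Phi w)%:E = (\sum_(0 <= i <oo) (phi i w)%:E)%E.
  rewrite fineK// ge0_fin_numE ?(le_lt_trans (sphi w)) ?ltry//.
  by apply: nneseries_ge0 => *.
exists Phi; split.
- by move=> w; rewrite -lee_fin PhiE; apply: nneseries_ge0 => *.
- move=> w; rewrite -lee_fin PhiE -sumEFin; under eq_bigr do rewrite PhiE.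
  rewrite -nneseries_sum; last by move=> *.
  apply: lee_nneseries => [i _ _|i _]; first exact: sume_ge0.
  by rewrite sumEFin lee_fin.
- move=> i w; rewrite -lee_fin PhiE.
  have := @nneseries_lim_ge _ (fun i => (phi i w)%:E) xpredT 0 i.+1 (fun n _ _ => phi0e n w).
  apply: le_trans; rewrite big_nat_recr//= sumEFin -EFinD lee_fin lerDr.
  exact: sumr_ge0.
- by rewrite -lee_fin PhiE.
move=> eps eps0.
have sboo : (\sum_(0 <= i <oo) (beta i)%:E < +oo)%E by rewrite (le_lt_trans sbeta) ?ltry.
have [I [_ HI]] := nneseries_tail_lt 0 (fun i _ => beta0e i) sboo eps0.
exists (\max_(i < I) k i).+1 => m Km; rewrite -lte_fin -sumEFin.
under eq_bigr do rewrite PhiE.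
rewrite -nneseries_sum; last by move=> *.
apply: le_lt_trans HI.
rewrite (nneseries_split 0 I); last by move=> *; exact: sume_ge0.
rewrite add0n big_nat big1 ?add0e => [|i /andP[_ iI]].
  apply: lee_nneseries => [i _ _|i _]; first exact: sume_ge0.
  rewrite sumEFin lee_fin (le_trans _ (phi_beta i [::]))//.
  exact: (@superadditive_sum_words (phi i) m [::]).
rewrite big_seq big1// => w; rewrite mem_words => /andP[/eqP sw _]; rewrite phi_supp// sw.
by rewrite (leq_ltn_trans _ Km)// (leq_bigmax (F := fun i : 'I_I => k i) (Ordinal iI)).
Unshelve. all: by end_near. Qed.

End SuperadditiveSeries.

Section Divergent.
Variables (R : realType) (b : nat) (D : {set 'I_b}) (f : R -> R) (psi : nat -> R).
Hypotheses (b2 : (2 <= b)%N) (D2 : (2 <= #|D|)%N).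
Hypothesis f_gt0 : forall r, 0 < r -> 0 < f r.
Hypothesis f_nd : forall r s, 0 < r -> r <= s -> f r <= f s.

Notation bn n := ((b%:R : R) ^+ n).
Notation q := (#|D|%:R^-1 : R).
Notation c := ((digit_gap D)%:R / (b%:R - 1) : R).
Notation C := (@cantor_set R b D).
Notation W := (W_set b psi).
Let r n := psi n - c / bn n.
Let J n := c / bn n < psi n.
Let a n := f (r n) * #|D|%:R ^+ n.
Let F n := f (bn n)^-1.
Hypothesis diva : diverges J a.

Let D0 : (0 < #|D|)%N := ltnW D2.
Let N0 : 0 < #|D|%:R :> R := card_gt0R R D2.
Let bnV_gt0 n : 0 < (bn n)^-1. Proof. by rewrite invr_gt0 baseX_gt0. Qed.
Let F_gt0 n : 0 < F n. Proof. exact: f_gt0. Qed.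

Let bnV_le m n : (m <= n)%N -> (bn n)^-1 <= (bn m)^-1.
Proof. by move=> mn; rewrite lef_pV2 ?posrE ?baseX_gt0// ler_eXn2l ?ltr1n. Qed.

Let F_ni m n : (m <= n)%N -> F n <= F m.
Proof. by move=> mn; rewrite f_nd// bnV_le. Qed.

Let qN n : q ^+ n * #|D|%:R ^+ n = 1.
Proof. by rewrite -exprMn mulVf ?expr1n// gt_eqF. Qed.

(** For n in [J], [s n] is chosen as the least s >= n with b^-s < r n, so b^-(s n) is comparable to
    r n unless s n = n. *)
Lemma run_levels_exist : exists s : nat -> nat, forall n, (n <= s n)%N /\
  (J n -> (bn (s n))^-1 < r n /\ (s n = n \/ (n < s n)%N /\ r n <= (bn (s n).-1)^-1)).
Proof.
suff H n : exists s, (n <= s)%N /\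
  (J n -> (bn s)^-1 < r n /\ (s = n \/ (n < s)%N /\ r n <= (bn s.-1)^-1)).
  by have [s Hs] := choice H; exists s.
have [Jn|/negP nJ] := boolP (J n); last by exists n.
have rn0 : 0 < r n by rewrite subr_gt0.
have [s0 Hs0] := baseXV_small b2 rn0.
pose P s := (n <= s)%N && ((bn s)^-1 < r n).
have Ps : P (maxn n s0).
  by rewrite /P leq_maxl/= (le_lt_trans _ Hs0)// bnV_le// leq_maxr.
case: (ex_minnP (ex_intro P _ Ps)) => s /andP[ns sr] smin; exists s; split=> // _; split=> //.
case: (ltngtP n s) ns => // [ns _|->]; [right|by left].
split=> //; rewrite leNgt; apply/negP => h.
have : P s.-1 by rewrite /P h andbT -ltnS (ltn_predK ns).
by move/smin; rewrite leqNgt ltn_predL (leq_ltn_trans _ ns).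
Qed.

Variables (e : 'I_b) (sd : bool) (s : nat -> nat).
Hypotheses (eD : e \in D) (esd : `|sd%:R - (val e)%:R / (b%:R - 1)| = c).
Hypothesis Hs : forall n, (n <= s n)%N /\
  (J n -> (bn (s n))^-1 < r n /\ (s n = n \/ (n < s n)%N /\ r n <= (bn (s n).-1)^-1)).

Let sge n : (n <= s n)%N := (Hs n).1.

Lemma limsup_runs x y : expands x y ->
  (forall m, exists n, [/\ (m <= n)%N, J n & forall i, (n <= i < s n)%N -> x i = e]) -> W y.
Proof.
move=> xy H; split; first exact: (expands01 b2 xy).
move=> /finite_seqP[A AE].
have [n [An Jn xe]] := H (\max_(i <- A) i.2).+1.
have : [set pn : nat * nat | `|y - pn.1%:R / bn pn.2| < psi pn.2] (wnum (mkseq x n) + sd, n)%N.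
  rewrite /=; apply: (le_lt_trans (run_badic_close b2 xy (sge n) xe esd)).
  by rewrite -ltrBrDl; have [] := (Hs n).2 Jn.
rewrite AE /= => nA.
have : ((wnum (mkseq x n) + sd, n).2 <= \max_(i <- A) i.2)%N by exact: leq_bigmax_seq.
by rewrite leqNgt An.
Qed.

Let a_le n : J n -> (n < s n)%N -> a n <= F (s n).-1 * #|D|%:R ^+ n.
Proof.
move=> Jn ns; apply: ler_wpM2r; first by rewrite exprn_ge0// ltW.
have [_ /(_ Jn)[_ [sn|[_ h]]]] := Hs n; first by move: ns; rewrite sn ltnn.
by rewrite f_nd// subr_gt0.
Qed.

(** * Bounded F(n) #D^n: the complement of the limsup set is null *)

Section Bounded.
Variable K : R.
Hypothesis FK : forall n, F n * #|D|%:R ^+ n <= K.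

Let K0 : 0 < K.
Proof. by apply: lt_le_trans (FK 0); rewrite expr0 mulr1. Qed.

Let avoiding m := [set y : R | exists x, [/\ forall i, x i \in D, expands x y &
  forall n, (m <= n)%N -> J n -> ~ (forall i, (n <= i < s n)%N -> x i = e)]].

(** If p = s n - 1 >= n, then a n <= F(p) #D^n = F(p) #D^p q^(p - n) <= K q^(p - n), so the run
    proportions inherit the divergence of [a]. *)
Let divq : diverges J (fun n => q ^+ (s n - n)).
Proof.
have KN0 : 0 < K * #|D|%:R by rewrite mulr_gt0.
apply: (@diverges_compare _ _ a _ _ 0 _ KN0 diva) => [n|n _ Jn]; first by rewrite exprn_ge0.
have := sge n; rewrite leq_eqVlt => /predU1P[<-|ns]; first by left; rewrite subnn.
right; apply: (le_trans (a_le Jn ns)).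
set p := (s n).-1; have np : (n <= p)%N by rewrite -ltnS (ltn_predK ns).
have -> : (s n - n)%N = (p - n).+1 by rewrite -subSn// (ltn_predK ns).
rewrite exprS -mulrA [_%:R * (_ * _)]mulrA divff ?gt_eqF// mul1r.
have -> : F p * #|D|%:R ^+ n = F p * #|D|%:R ^+ p * q ^+ (p - n).
  have -> : #|D|%:R ^+ p = #|D|%:R ^+ (p - n) * #|D|%:R ^+ n :> R by rewrite -exprD subnK.
  by rewrite -[LHS]mulr1 -[X in _ * X = _](qN (p - n)); ring.
by rewrite ler_wpM2r// exprn_ge0.
Qed.

Let avoiding_null m : hausdorff_measure f (avoiding m) = 0%E.
Proof.
apply/eqP; rewrite eq_le hausdorff_measure_ge0// andbT.
apply: hausdorff_measure_le => d d0; apply/lee_addgt0Pr => eps eps0; rewrite add0e.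
(* The cover will cost at most K times the proportion 2 / (S + 2) of words without a run, which is
   below [eps] once S >= 2 K / eps. *)
have [M HM] := divq (2 * K / eps) m.
have [Z0 HZ0] := baseXV_small b2 d0.
pose Z := (Z0 + M + \max_(n < M) s n)%N.
pose J' n := (m <= n)%N && J n.
have sZ n : (n < M)%N -> (s n <= Z)%N.
  move=> nM; rewrite (leq_trans _ (leq_addl _ _))//.
  by rewrite (leq_bigmax (F := fun n : 'I_M => s n) (Ordinal nM)).
have lZ n : (n < M)%N -> J' n -> (n + (s n - n) <= Z)%N by move=> nM _; rewrite subnKC ?sZ.
have MZ : (M <= Z)%N by rewrite /Z -addnA addnCA leq_addr.
pose av z := ~~ has (fun n => J' n && run e n (s n - n) z) (index_iota 0 M).
pose S := \sum_(0 <= n < M | J' n) q ^+ (s n - n).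
have avS : avg D Z (fun z => (av z)%:R) * (S + 2) <= 2 := avg_avoid_runs R D2 eD lZ MZ.
have SE : 2 * K / eps <= S.
  rewrite (le_trans (ltW HM))// (big_nat_widenl m 0)//= /S.
  by under eq_bigl do rewrite andbC.
have S0 : 0 < S by rewrite (lt_le_trans _ SE)// divr_gt0// mulr_gt0.
pose ws := [seq w <- words D Z | av w].
have szws : (size ws)%:R = #|D|%:R ^+ Z * avg D Z (fun z => (av z)%:R) :> R.
  rewrite /avg mulrA [_ ^+ Z * _]mulrC qN mul1r size_filter -sum1_count natr_sum.
  by rewrite big_mkcond; apply: eq_bigr => w _; case: (av w).
have bZ : (bn Z)^-1 <= d by rewrite (le_trans _ (ltW HZ0))// bnV_le// /Z -addnA leq_addr.
apply: (@le_trans _ _ (F Z *+ size ws)%:E).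
  pose cyl (w : seq 'I_b) := [set y : R | exists x, expands x y /\ mkseq x Z = w].
  apply: (@le_trans _ _ (hausdorff_content f d [set y | exists2 w, w \in ws & cyl w y])).
    apply: le_hausdorff_content => // y [x [xD xy xav]]; exists (mkseq x Z); last by exists x.
    rewrite mem_filter mkseq_words// andbT /av; apply/hasPn => n; rewrite mem_index_iota /= => nM.
    apply/negP => /andP[/andP[mn Jn] rn]; apply: (xav n mn Jn) => i /andP[ni iS].
    rewrite -[LHS](nth_mkseq e x (n := Z)); last by rewrite (leq_trans iS)// sZ.
    by apply: (run_nth rn); rewrite ni subnKC.
  apply: hausdorff_content_seq => // w _; apply: diam_le => y y' [x [xy xw]] [x' [xy' xw']].
  apply: (expands_close b2 xy xy') => i iZ.
  have := congr1 (fun w => nth (x i) w i) (etrans xw (esym xw')).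
  by rewrite !nth_mkseq.
rewrite lee_fin -mulr_natr szws mulrA.
apply: (@le_trans _ _ (K * avg D Z (fun z => (av z)%:R))).
  by rewrite ler_wpM2r// avg_ge0.
have S2 : 0 < S + 2 by rewrite addr_gt0.
rewrite -(ler_pM2r S2) -mulrA (le_trans (ler_wpM2l (ltW K0) avS))//.
apply: (@le_trans _ _ (eps * S)); last by rewrite ler_pM2l// lerDl.
by rewrite [leLHS]mulrC [leRHS]mulrC -ler_pdivrMr.
Qed.

Lemma hausdorff_limsup_bounded :
  hausdorff_measure f (W `&` C) = hausdorff_measure f C.
Proof.
apply/eqP; rewrite eq_le; apply/andP; split.
  by apply: le_hausdorff_measure => // x [].
apply: le_trans (hausdorff_measure_setUnull f_gt0 (W `&` C) avoiding_null).
apply: le_hausdorff_measure => // y Cy; have [x [xD xy]] := Cy.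
have [Wy|Wy] := pselect (W y); [by left|right].
suff [m Hm] : exists m, forall n, (m <= n)%N -> J n -> ~ forall i, (n <= i < s n)%N -> x i = e.
  by exists m => //; exists x.
apply: contrapT => H; apply: Wy; apply: (limsup_runs xy) => m.
apply: contrapT => H'; apply: H; exists m => n mn Jn xe; apply: H'.
by exists n.
Qed.

End Bounded.

(** * Unbounded nondecreasing G: infinite measure *)

Section Unbounded.
Hypothesis f_small : forall eps, 0 < eps -> exists2 r, 0 < r & f r < eps.
Let G n := F n * #|D|%:R ^+ n.
Hypotheses (G_nd : forall n, G n <= G n.+1) (G_unb : forall K, exists n, K < G n).

Let G_le m n : (m <= n)%N -> G m <= G n.
Proof. by move=> mn; apply: (homo_leq (@le_refl _ R) (@le_trans _ R)). Qed.

(** Monotonicity of G acts as a doubling condition on [F]. *)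
Let F_doubling n : F n <= #|D|%:R * F n.+1.
Proof.
have Nn : 0 < #|D|%:R ^+ n :> R by rewrite exprn_gt0.
by rewrite -(ler_pM2r Nn) (le_trans (G_nd n))// /G exprS mulrCA mulrA.
Qed.

Let F_small eps : 0 < eps -> exists n, F n < eps.
Proof.
move=> /f_small[t t0 ft]; have [n nt] := baseXV_small b2 t0.
by exists n; rewrite (le_lt_trans _ ft)// f_nd// ltW.
Qed.

(** Choose the deepest k with diam U <= b^-k; doubling then compares F k with f(diam U). A set
    without positive diameter contributes nothing, so it is given a level deep enough that F k <
    eps. *)
Let cover_level (U : set R) s0 eps : 0 < eps -> (diam U <= ((bn s0)^-1)%:E)%E ->
  exists k, [/\ (s0 <= k)%N, (diam U <= ((bn k)^-1)%:E)%E &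
    F k <= #|D|%:R * fine (hcontrib f U) + eps].
Proof.
move=> eps0 dU; have [[t t0 dE]|H] := pselect (exists2 t : R, 0 < t & diam U = t%:E); last first.
  have [k Fk] := F_small eps0; exists (maxn s0 k); split; first by rewrite leq_maxl.
    move: H dU; case: (diam U) => [t||]//= H _; rewrite ?leNye// lee_fin.
    rewrite (le_trans (y := 0)) ?(ltW (bnV_gt0 _))// leNgt; apply/negP => t0.
    by apply: H; exists t.
  rewrite (le_trans (F_ni (leq_maxr s0 k)))// (le_trans (ltW Fk))// lerDr mulr_ge0 ?(ltW N0)//.
  by rewrite fine_ge0// hcontrib_ge0.
pose P k := (bn k)^-1 < t.
have [k0 Pk0] : exists k, P k by exact: baseXV_small.
case: (ex_minnP (ex_intro P _ Pk0)) => k Pk kmin.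
have sk : (s0 < k)%N.
  rewrite ltnNge; apply/negP => ks; move: dU; rewrite dE lee_fin leNgt.
  by rewrite (le_lt_trans _ Pk)// bnV_le.
have kE : k.-1.+1 = k := ltn_predK sk.
exists k.-1; split; first by rewrite -ltnS kE.
  rewrite dE lee_fin leNgt; apply/negP => /kmin.
  by rewrite leqNgt -{2}kE ltnS leqnn.
rewrite (le_trans (F_doubling _))// kE.
rewrite (le_trans (y := #|D|%:R * fine (hcontrib f U))) ?lerDl ?(ltW eps0)//.
rewrite ler_pM2l// /hcontrib dE t0/=.
by rewrite f_nd// ltW.
Qed.

Let meets (U : set R) k (w : seq 'I_b) :=
  exists (y : R) x, [/\ U y, forall i, x i \in D, expands x y & mkseq x k = w].

(* Two words of length k meeting U have numerators [wnum] differing by at most 2. *)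
Let count_meets U k : (diam U <= ((bn k)^-1)%:E)%E ->
  (count (fun w => `[< meets U k w >]) (words D k) <= 5)%N.
Proof.
move=> dU; rewrite -size_filter; set ws := [seq w <- _ | _].
case: (posnP (size ws)) => [->//|]; rewrite -has_predT => /hasP[w0 w0s _].
have mw w : w \in ws -> meets U k w by rewrite mem_filter => /andP[/asboolP].
have sw w : w \in ws -> size w = k.
  by rewrite mem_filter mem_words => /andP[_ /andP[/eqP]].
rewrite -(size_map (@wnum b)) -[leqRHS](size_iota (wnum w0 - 2) 5).
apply: uniq_leq_size.
  rewrite map_inj_in_uniq ?filter_uniq ?words_uniq// => v w vs wsw.
  by apply: (wnum_inj b2); rewrite !sw.
move=> _ /mapP[w ws' ->]; rewrite mem_iota.
have [y [x [Uy _ xy xw]]] := mw _ ws'; have [y' [x' [Uy' _ xy' xw']]] := mw _ w0s.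
have : `|y - y'| <= (bn k)^-1 by rewrite -lee_fin (le_trans (diam_ge Uy Uy')).
have [z /(expands01 b2)/andP[z0 z1] ->] := expands_tail b2 k xy.
have [z' /(expands01 b2)/andP[z'0 z'1] ->] := expands_tail b2 k xy'.
rewrite xw xw' -mulrBl normrM (ger0_norm (ltW (bnV_gt0 k))) -[leRHS]mul1r ler_pM2r//.
rewrite ler_norml => /andP[h1 h2].
have : (wnum w)%:R <= (wnum w0)%:R + 2 :> R by lra.
have : (wnum w0)%:R <= (wnum w)%:R + 2 :> R by lra.
rewrite -!natrD !ler_nat; clear; lia.
Qed.

(** At most one letter d continues [w] to a prefix of [z], so no word is counted twice on the left.
    This makes the costs [phi i] below superadditive. *)
Let count_prefix_rcons U k w :
  (\sum_(d in D) count (fun z => prefix (rcons w d) z && `[< meets U k z >]) (words D k)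
   <= count (fun z => prefix w z && `[< meets U k z >]) (words D k))%N.
Proof.
under eq_bigr do rewrite -sum1_count big_mkcond.
rewrite exchange_big -sum1_count [leqRHS]big_mkcond /=.
apply: leq_sum => z _; case: `[< _ >]; last by rewrite big1 => [|d _]; rewrite ?andbF.
under eq_bigr do rewrite andbT; rewrite andbT.
have [wz|wz] := boolP (prefix w z); last first.
  rewrite big1// => d _; case: ifP => // h; move: wz.
  by rewrite (prefix_trans _ h)// prefix_rcons.
move/prefixP: wz => [z' ->]; case: z' => [|d' z'].
  rewrite big1// => d _; case: ifP => //; rewrite cats0 => /size_prefix.
  by rewrite size_rcons ltnn.
have pE d : prefix (rcons w d) (w ++ d' :: z') = (d == d').
  by clear; elim: w => [|h w IH] /=; rewrite ?prefix0s ?andbT ?eqxx.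
under eq_bigr do rewrite pE; rewrite -big_mkcondr /= sum1_card.
rewrite (leq_trans (subset_leq_card (_ : _ \subset pred1 d'))) ?card1//.
by apply/fintype.subsetP => d; rewrite !inE => /andP[].
Qed.

Lemma hausdorff_limsup_unbounded : hausdorff_measure f (W `&` C) = +oo%E.
Proof.
apply/eqyP => M M0.
(* [B] bounds the total of the [beta i]: each covering set is charged for at most 5 words, doubling
   costs #D, and the errors 2^-(i+1) sum to at most 1. *)
pose B : R := 5 * (#|D|%:R * M + 1).
(* At this level the average of [Phi] is at most B #D^-s0 < F(s0) / 2, which will provide a good
   starting word. *)
have [s0 Hs0] := G_unb (2 * B).
apply: (@le_trans _ _ (hausdorff_content f (bn s0)^-1 (W `&` C))); last first.
  by apply: ereal_sup_ubound; exists (bn s0)^-1 => //=.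
apply: le_ereal_inf_tmp => _ /= [U [WU dU] <-]; rewrite leNgt; apply/negP => UM.
have h0 i : 0 <= fine (hcontrib f (U i)) by rewrite fine_ge0// hcontrib_ge0.
have hfin i : hcontrib f (U i) \is a fin_num.
  by rewrite /hcontrib; case: (diam _) => // t; case: ifP.
have /choice[k Hk] : forall i, exists k, [/\ (s0 <= k)%N, (diam (U i) <= ((bn k)^-1)%:E)%E &
    F k <= #|D|%:R * fine (hcontrib f (U i)) + 2^-1 ^+ i.+1].
  by move=> i; apply: cover_level => //; rewrite exprn_gt0// invr_gt0.
pose bad i w := `[< meets (U i) (k i) w >].
(* The cost of U i is spread over the cylinders of level k i that it meets; [phi i w] is the share
   below [w]. *)
pose phi i w : R := F (k i) * (count (fun z => prefix w z && bad i z) (words D (k i)))%:R.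
pose beta i := F (k i) * 5.
have betaB n : \sum_(0 <= i < n) beta i <= B.
  rewrite -mulr_suml mulrC ler_pM2l//.
  apply: (@le_trans _ _ (\sum_(0 <= i < n) (#|D|%:R * fine (hcontrib f (U i)) + 2^-1 ^+ i.+1))).
    by apply: ler_sum => i _; have [] := Hk i.
  rewrite big_split/= lerD//; last first.
    suff -> : \sum_(0 <= i < n) 2^-1 ^+ i.+1 = 1 - 2^-1 ^+ n :> R.
      by rewrite lerBlDr lerDl exprn_ge0// invr_ge0.
    elim: n => [|n IH]; first by rewrite big_geq// expr0 subrr.
    by rewrite big_nat_recr//= IH exprS; lra.
  rewrite -mulr_sumr ler_pM2l// -lee_fin -sumEFin (le_trans _ (ltW UM))//.
  under eq_bigr do rewrite fineK//.
  by apply: (@nneseries_lim_ge _ _ xpredT) => *; exact: hcontrib_ge0.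
have phi0 i w : 0 <= phi i w by rewrite mulr_ge0// ltW.
have phiS i w : \sum_(d in D) phi i (rcons w d) <= phi i w.
  by rewrite -mulr_sumr ler_pM2l// -natr_sum ler_nat count_prefix_rcons.
have phib i w : phi i w <= beta i.
  have [_ dk _] := Hk i; rewrite ler_pM2l// (ler_nat _ _ 5) (leq_trans _ (count_meets dk))//.
  by apply: sub_count => z /andP[].
have phi_supp i w : (k i < size w)%N -> phi i w = 0.
  move=> kw; rewrite /phi (eq_in_count (a2 := pred0)) ?count_pred0 ?mulr0// => z.
  rewrite mem_words => /andP[/eqP sz _]; apply/negbTE; rewrite negb_and; apply/orP; left.
  by apply: contraTN kw => /size_prefix; rewrite sz -leqNgt.
have [Phi [Phi0 PhiS phiPhi PhiB Philim]] := superadditive_series phi0 phiS phib phi_supp betaB.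
pose Bad w := exists i, size w = k i /\ w \in words D (k i) /\ bad i w.
have BadPhi w : Bad w -> F (size w) <= Phi w.
  move=> [i [sw [wD wb]]]; apply: le_trans (phiPhi i w).
  rewrite /phi sw -[leLHS]mulr1 ler_pM2l// (ler_nat _ 1) -has_count.
  by apply/hasP; exists w => //; rewrite prefix_refl.
have : avg D s0 Phi < 2^-1 * F s0.
  have Ns0 : 0 < #|D|%:R ^+ s0 :> R by rewrite exprn_gt0.
  rewrite -(ltr_pM2l Ns0) /avg mulrA [_ ^+ s0 * _]mulrC qN mul1r.
  rewrite (le_lt_trans (@superadditive_sum_words _ _ _ _ s0 [::] PhiS))// (le_lt_trans PhiB)//.
  by rewrite mulrCA [_ ^+ s0 * _]mulrC -/(G s0); lra.
move=> /(avg_lt_ex D2)[u0]; rewrite mem_words => /andP[/eqP su0 u0D] Phiu0.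
have Gu0 : good D F Phi Bad u0.
  split; rewrite ?su0// => i Bi; have := BadPhi _ Bi.
  have [j [sj _]] := Bi; have [ks _ _] := Hk j.
  (* Bad words have length k j >= s0, so the only prefix of [u0] that could be bad is [u0]
     itself. *)
  have tE : take i u0 = u0.
    apply: take_oversize; move: ks; rewrite -sj size_take su0.
    by case: ltnP => // h; rewrite leqNgt h.
  by rewrite tE su0 leNgt (lt_trans Phiu0)// gtr_pMl// invf_lt1// ltr1n.
have a_doubling n : J n -> s n = n \/ a n <= #|D|%:R * (F (s n) * #|D|%:R ^+ n).
  move=> Jn; have := sge n; rewrite leq_eqVlt => /predU1P[|ns]; [by left|right].
  rewrite (le_trans (a_le Jn ns))// mulrA ler_wpM2r ?exprn_ge0 ?(ltW N0)//.
  by rewrite (le_trans (F_doubling _))// (ltn_predK ns).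
have [x [xD xB xrun]] := limsup_avoiding D2 eD (fun n => erefl (G n)) F_gt0 F_ni G_le Phi0 PhiS
  BadPhi Philim sge N0 diva a_doubling Gu0.
have [y xy] := expands_exists R b2 x.
have /WU[i _ Uy] : (W `&` C) y by split; [exact: (limsup_runs xy)|exists x].
apply: (xB (k i)); exists i; rewrite size_mkseq mkseq_words//; split=> //; split=> //.
by apply/asboolP; exists y, x.
Qed.

End Unbounded.

End Divergent.

(** * The exponent gamma and the alternative for G *)

Lemma digit_density_pow (R : realType) (b N n : nat) : (2 <= b)%N -> (1 <= N)%N ->
  ((b%:R ^+ n)^-1 : R) `^ (- (ln N%:R / ln b%:R)) = N%:R ^+ n.
Proof.
move=> b2 N1; have b0 : 0 <= b%:R :> R by [].
by rewrite -[b%:R ^+ n]powR_mulrn// -powRN -powRrM mulrNN powR_log.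
Qed.

Theorem theorem1p3 (R : realType) (b : nat) (D : {set 'I_b})
  (f : R -> R) (psi : nat -> R) :
  let gamma : R := ln (#|D|%:R : R) / ln (b%:R : R) in
  (3 <= b)%N -> (2 <= #|D|)%N -> (#|D| <= b.-1)%N ->
  dimension_function f ->
  monotonic_pos (fun r => r `^ (- gamma) * f r) ->
  (forall n, 0 < psi n) ->
  let m : R := (digit_gap D)%:R in
  let S : \bar R :=
    (\sum_(1 <= n <oo | (m / ((b%:R - 1) * b%:R ^+ n) < psi n)%R)
       (f (psi n - m / ((b%:R - 1) * b%:R ^+ n))
         * (b%:R : R) `^ (n%:R * gamma))%:E)%E in
  ((S < +oo)%E -> hausdorff_measure f (W_set b psi `&` @cantor_set R b D) = 0%E) /\
  (S = +oo%E -> hausdorff_measure f (W_set b psi `&` @cantor_set R b D)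
               = hausdorff_measure f (@cantor_set R b D)).
Proof.
move=> gamma b3 D2 _ [f0 _ fnd flim] gmono _ m S.
have b2 : (2 <= b)%N := ltnW b3.
have D1 : (1 <= #|D|)%N := ltnW D2.
pose J n := m / (b%:R - 1) / b%:R ^+ n < psi n.
pose a n := f (psi n - m / (b%:R - 1) / b%:R ^+ n) * #|D|%:R ^+ n.
have SE : S = (\sum_(1 <= n <oo | J n) (a n)%:E)%E.
  have mE n : m / ((b%:R - 1) * b%:R ^+ n) = m / (b%:R - 1) / b%:R ^+ n.
    by rewrite invfM mulrA.
  rewrite /S; under eq_eseriesl do rewrite mE.
  by apply: eq_eseriesr => n _; rewrite mE powR_log.
rewrite SE; split; first exact: hausdorff_measure_limsup0.
have a0 n : J n -> 0 <= a n by move=> Jn; rewrite mulr_ge0 ?exprn_ge0// ltW// f0// subr_gt0.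
move=> /(nneseries_diverges a0) diva.
have [s Hs] := run_levels_exist D psi b2.
have [e [sd [eD esd]]] := digit_gap_attained R b2 D1.
pose G n := f (b%:R ^+ n)^-1 * #|D|%:R ^+ n.
have bV0 n : 0 < (b%:R ^+ n)^-1 :> R by rewrite invr_gt0 baseX_gt0.
have bV i j : (i <= j)%N -> (b%:R ^+ j)^-1 <= (b%:R ^+ i)^-1 :> R.
  by move=> ij; rewrite lef_pV2 ?posrE ?baseX_gt0// ler_eXn2l ?ltr1n.
have GE n : G n = (b%:R ^+ n)^-1 `^ (- gamma) * f (b%:R ^+ n)^-1.
  by rewrite /G /gamma digit_density_pow// mulrC.
have [[K GK]|Gunb] := pselect (exists K, forall n, G n <= K).
  exact: (hausdorff_limsup_bounded b2 D2 f0 fnd diva eD esd Hs GK).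
have Gub K : exists n, K < G n.
  apply: contra_notP Gunb => H; exists K => n; rewrite leNgt; apply/negP => h.
  by apply: H; exists n.
(* G n is r^-gamma f(r) at r = b^-n. If that function is nondecreasing in r, G is bounded by G 0; so
   unbounded G leaves the nonincreasing case, where G is nondecreasing in n. *)
case: gmono => gmono.
  by case: Gunb; exists (G 0%N) => n; rewrite !GE gmono// bV.
have Gnd n : G n <= G n.+1 by rewrite !GE gmono// bV.
have fsmall eps : 0 < eps -> exists2 t, 0 < t & f t < eps.
  move=> eps0; near (0 : R)^'+ => t; exists t => //.
  rewrite (le_lt_trans (ler_norm _))// -normrN -sub0r.
  by near: t; move/cvgrPdist_lt : flim => /(_ _ eps0).
have WC := hausdorff_limsup_unbounded b2 D2 f0 fnd diva eD esd Hs fsmall Gnd Gub.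
rewrite WC; apply/esym/eqP; rewrite -leye_eq -WC.
by apply: le_hausdorff_measure => // x [].
Unshelve. all: by end_near. Qed.
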